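(* There exist distributional solutions $H^{\mathbf r}$ and $H^{\mathbf s}$, both supported in the light cone $\mathcal K=\{(\nu,s):|s|\le k(\nu)\}$, of the initial value problems in $(0,\nu_{\rm cr})\times\mathbb R$: $$\begin{cases}H^{\mathbf r}_{\nu\nu}-\frac{M^2-1}{\varrho^2}H^{\mathbf r}_{ss}=0,\\ H^{\mathbf r}|_{\nu=0}=0,\\ H^{\mathbf r}_\nu|_{\nu=0}=\delta_0,\end{cases}\qquad \begin{cases}H^{\mathbf s}_{\nu\nu}-\frac{M^2-1}{\varrho^2}H^{\mathbf s}_{ss}=0,\\ H^{\mathbf s}|_{\nu=0}=\delta_0,\\ \varrho H^{\mathbf s}_\nu|_{\nu=0}=-\delta_0'',\end{cases}$$ where the initial conditions are understood as limits as $\nu\to0^+$ (in the sense of distributions in $s$).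
   Context: Standing setting ($\gamma=3$): $\varrho=\sqrt{1-q^2}$ is the density for speed $q\in[0,1]$, $M=q/\varrho$ the Mach number; the renormalized density is $\nu(\varrho)=\int_0^\varrho\frac{\tau^2}{1-\tau^2}d\tau$, with inverse $\varrho(\nu)$, and $\nu_{\rm cr}=\nu(1/\sqrt2)$ (sonic, $M=1$). The characteristic speed $k$ on $[0,\nu_{\rm cr}]$ satisfies $k(0)=0$, $k'(\nu)=\sqrt{1-2\varrho(\nu)^2}/\varrho(\nu)^2$, so $k'^2=(M^2-1)/\varrho^2$. $\delta_0$ is the Dirac mass at $0$. *)

(* Defs.v *)
From Stdlib Require Import Reals.
From Coquelicot Require Import Coquelicot.
Open Scope R_scope.

(* renormalized density  nu(rho) = int_0^rho tau^2/(1-tau^2) dtau   (gamma = 3) *)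
Definition nu_of_rho (r : R) : R := RInt (fun t => t ^ 2 / (1 - t ^ 2)) 0 r.

(* sonic value nu_cr = nu(1/sqrt 2) *)
Definition nu_cr : R := nu_of_rho (1 / sqrt 2).

(* Mach number as a function of the density: q = sqrt(1-rho^2), M = q/rho *)
Definition mach (r : R) : R := sqrt (1 - r ^ 2) / r.

Definition is_test_fun (phi : R -> R) : Prop :=
  (forall (n : nat) (x : R), ex_derive_n phi n x) /\
  (exists M : R, forall x, M < Rabs x -> phi x = 0).

Definition is_distribution (T : (R -> R) -> R) : Prop :=
  (forall phi psi a b, is_test_fun phi -> is_test_fun psi ->
     T (fun x => a * phi x + b * psi x) = a * T phi + b * T psi) /\
  (forall M : R, exists (C : R) (m : nat),
     forall (phi : R -> R) (B : nat -> R), is_test_fun phi ->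
       (forall x, M < Rabs x -> phi x = 0) ->
       (forall (j : nat) x, (j <= m)%nat -> Rabs (Derive_n phi j x) <= B j) ->
       Rabs (T phi) <= C * sum_f_R0 B m).

Definition supported_in_interval (T : (R -> R) -> R) (a : R) : Prop :=
  forall phi, is_test_fun phi ->
    (exists eps, 0 < eps /\ forall x, Rabs x < a + eps -> phi x = 0) ->
    T phi = 0.

(* H : nu |-> H(nu) in D'(R), solving  H_{nu nu} - (M^2-1)/rho^2 H_{ss} = 0
   on (0, nu_cr) x R, in the sense of distributions in s, twice (weakly)
   differentiable in nu. *)
Definition wave_solution (rho : R -> R) (H : R -> (R -> R) -> R) : Prop :=
  forall nu, 0 < nu < nu_cr -> forall phi, is_test_fun phi ->
    ex_derive (fun t => H t phi) nu /\
    is_derive (fun t => Derive (fun t' => H t' phi) t) nu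
      (((mach (rho nu)) ^ 2 - 1) / (rho nu) ^ 2 * H nu (Derive_n phi 2)).

(* Main.v *)
Require Import Defs.
From Stdlib Require Import Reals Ranalysis5 Lra Lia FunctionalExtensionality.
From Coquelicot Require Import Coquelicot.
Open Scope R_scope.

(* Proof idea.  In the density variable r the equation in its first-order form has two
   Riemann invariants H_nu +- k' H_s, transported along the characteristics s +- k and
   coupled by a coefficient [coupling] ~ 1/r which is singular at the vacuum.  With zero
   data and a source f(r) g(s), f = O(r^2), iterating along characteristics is a
   contraction with factor 2/3 for the weight r^3 / (1 - 2 r^2), and the n-th iterate
   only sees g on |s| <= k.  The singular initial data are removed beforehand by an
   explicit finite expansion sum_j al_j(r) delta_0^(2j), chosen so that the residual in
   the equation is sum_j f_j(r) delta_0^(2j) with f_j = O(r^2).  Everything is read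
   through test functions evaluated at s = 0, s-translation being [shift]. *)

(** The vacuum is the obstacle. Nonzero data would meet the coupling 1/r, which is not integrable,
    so the iteration cannot start from them; it needs unknowns of size r^p with p > 2, and a
    residual O(r^2) is what produces p = 3. Hence the data are peeled off by hand before anything is
    iterated. The derivatives of delta_0 in the residual do not enter the iteration either: the
    coefficients do not depend on s, so a source f(r) delta_0^(2j) is solved by taking the source
    f(r) delta_0 and testing with the (2j)-th derivative of the test function. Every iterated
    functional thus has order zero, and derivatives are lost only once, at the end. The first-order
    system is larger than the wave equation: its two unknowns come from one H only through a
    compatibility relation, proved with the integrating factor 1/k'(nu), which is where [coupling]
    originates. The density replaces nu because the coefficients become explicit in r and dk/dr
    stays bounded, whereas k'(nu) is of size r^-2 at the vacuum. *)

Lemma differentiable_continuous (f : R -> R) x : ex_derive f x -> continuous f x.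
Proof. exact (ex_derive_continuous f x). Qed.

Lemma is_derive_eq (f : R -> R) (x l l' : R) :
  is_derive f x l -> l = l' -> is_derive f x l'.
Proof. now intros H <-. Qed.

(** * Continuity and integration on the supersonic range of densities *)

Definition dom (t : R) : Prop := 0 <= t /\ 2 * t ^ 2 < 1.

(** Relative continuity, hence one-sided at the vacuum density 0, where integrals along
    characteristics start and where functions of the density matter only to the right. *)
Definition continuous_dom (F : R -> R) : Prop :=
  forall t, dom t -> forall eps, 0 < eps ->
  exists delta, 0 < delta /\
    forall t', dom t' -> Rabs (t' - t) < delta -> Rabs (F t' - F t) < eps.

Lemma dom_ge0 t : dom t -> 0 <= t.
Proof. intros H; apply H. Qed.

Lemma dom_lt_1 t : dom t -> t < 1.
Proof. intros [H1 H2]; nra. Qed.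

Lemma dom_le t r : dom r -> 0 <= t <= r -> dom t.
Proof. intros [H1 H2] H; split; nra. Qed.

Lemma dom_locally r : 0 < r -> dom r -> locally r (fun x => 0 < x /\ dom x).
Proof.
intros Hr [H1 H2].
assert (Hd : 0 < (1 - 2 * r ^ 2) / 8) by lra.
assert (Hm : 0 < Rmin r ((1 - 2 * r ^ 2) / 8)) by (apply Rmin_pos; lra).
exists (mkposreal _ Hm); intros y Hy.
change (Rabs (y - r) < Rmin r ((1 - 2 * r ^ 2) / 8)) in Hy.
pose proof (Rmin_l r ((1 - 2 * r ^ 2) / 8)).
pose proof (Rmin_r r ((1 - 2 * r ^ 2) / 8)).
apply Rabs_def2 in Hy.
unfold dom; repeat split; try lra.
assert (r < 1) by nra.
nra.
Qed.

Lemma continuous_dom_continuous F :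
  (forall t, dom t -> continuous F t) -> continuous_dom F.
Proof.
intros H t Ht eps He.
destruct (proj1 (filterlim_locally F (F t)) (H t Ht) (mkposreal _ He)) as [d Hd].
exists d; split; [apply cond_pos | intros t' _ Htt'; exact (Hd t' Htt')].
Qed.

Lemma continuous_continuous_dom F r :
  continuous_dom F -> 0 < r -> dom r -> continuous F r.
Proof.
intros H Hr Hd; apply filterlim_locally; intros eps.
destruct (H r Hd eps (cond_pos eps)) as [d [Hd0 Hd1]].
generalize (dom_locally r Hr Hd); intros Hl.
assert (Hl2 : locally r (fun x => Rabs (x - r) < d))
  by (exists (mkposreal _ Hd0); intros y Hy; exact Hy).
generalize (filter_and _ _ Hl Hl2); apply filter_imp.
intros x [[_ Hx] Hx2]; exact (Hd1 x Hx Hx2).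
Qed.

Lemma ex_RInt_dom F a b :
  continuous_dom F -> dom a -> dom b -> a <= b -> ex_RInt F a b.
Proof.
intros H Ha Hb Hab.
(* Clamping the argument to [a, b] turns relative continuity into continuity on the whole line and
   leaves the integrand unchanged on the interval. *)
set (cl := fun t => Rmax a (Rmin b t)).
assert (Hcl : forall t, a <= cl t <= b).
{ intros t; unfold cl; split; [apply Rmax_l|].
  apply Rmax_lub; [lra | apply Rmin_l]. }
assert (Hlip : forall t t', Rabs (cl t' - cl t) <= Rabs (t' - t)).
{ intros t t'; unfold cl, Rmax, Rmin, Rabs; repeat destruct Rle_dec;
  repeat destruct Rcase_abs; lra. }
apply (ex_RInt_ext (fun t => F (cl t))).
{ intros x; rewrite Rmin_left, Rmax_right by lra; intros Hx.
  unfold cl; rewrite Rmin_right, Rmax_right by lra; reflexivity. }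
apply (ex_RInt_continuous (V := R_CompleteNormedModule)); intros z _.
assert (Hz : dom (cl z)) by (apply (dom_le _ b Hb); split; [|apply Hcl];
  destruct Ha; generalize (Hcl z); lra).
apply filterlim_locally; intros eps.
destruct (H (cl z) Hz eps (cond_pos eps)) as [d [Hd0 Hd1]].
exists (mkposreal _ Hd0); intros y Hy; apply Hd1.
- apply (dom_le _ b Hb); split; [|apply Hcl];
  destruct Ha; generalize (Hcl y); lra.
- apply Rle_lt_trans with (1 := Hlip z y); exact Hy.
Qed.

Lemma continuous_dom_lin a b F G :
  continuous_dom F -> continuous_dom G ->
  continuous_dom (fun t => a * F t + b * G t).
Proof.
intros HF HG t Ht eps He.
assert (Hp : 0 < eps / (2 * (Rabs a + Rabs b + 1))).
{ apply Rdiv_lt_0_compat; generalize (Rabs_pos a), (Rabs_pos b); lra. }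
destruct (HF t Ht _ Hp) as [d1 [Hd1 H1]], (HG t Ht _ Hp) as [d2 [Hd2 H2]].
exists (Rmin d1 d2); split; [now apply Rmin_pos|]; intros t' Ht' Htt'.
specialize (H1 t' Ht' (Rlt_le_trans _ _ _ Htt' (Rmin_l _ _))).
specialize (H2 t' Ht' (Rlt_le_trans _ _ _ Htt' (Rmin_r _ _))).
set (e := eps / _) in *.
replace (_ - _) with (a * (F t' - F t) + b * (G t' - G t)) by ring.
apply Rle_lt_trans with (1 := Rabs_triang _ _); rewrite !Rabs_mult.
assert (eps = 2 * (Rabs a + Rabs b + 1) * e)
  by (unfold e; field; generalize (Rabs_pos a), (Rabs_pos b); lra).
generalize (Rabs_pos a), (Rabs_pos b), (Rabs_pos (F t' - F t)),
  (Rabs_pos (G t' - G t)); intros; nra.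
Qed.

Lemma abs_RInt_le_dom F G a b :
  continuous_dom F -> dom a -> dom b -> a <= b ->
  ex_RInt G a b ->
  (forall t, a <= t <= b -> Rabs (F t) <= G t) ->
  Rabs (RInt F a b) <= RInt G a b.
Proof.
intros HF Ha Hb Hab HG Hle.
apply (norm_RInt_le (V := R_NormedModule) F G a b _ _ Hab).
- exact Hle.
- apply (RInt_correct F); now apply ex_RInt_dom.
- now apply (RInt_correct G).
Qed.

(** * Characteristic speed, coupling and weight in the density variable *)

(* dk/dr, once nu is replaced by the density r. *)
Definition speed (t : R) : R := sqrt (1 - 2 * t ^ 2) / (1 - t ^ 2).
(* Half the logarithmic derivative of r^2 / sqrt (1 - 2 r^2) = 1 / k'(nu). *)
Definition coupling (t : R) : R := / t + t / (1 - 2 * t ^ 2).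
(** For a factor t^p the ratio of [2 * coupling] times the weight to its derivative tends to 2/p at
    the vacuum, so p must exceed 2; a factor (1 - 2 t^2)^(-m) makes it tend to 1/(2m) at the sonic
    density. The choice p = 3, m = 1 gives 2/3 and 1/2. *)
Definition weight (t : R) : R := t ^ 3 / (1 - 2 * t ^ 2).
Definition dweight (t : R) : R :=
  3 * t ^ 2 / (1 - 2 * t ^ 2) + 4 * t ^ 4 / (1 - 2 * t ^ 2) ^ 2.

Lemma is_derive_weight t : dom t -> is_derive weight t (dweight t).
Proof.
intros [H1 H2]; unfold weight, dweight; auto_derive; [nra|field; nra].
Qed.

Lemma continuous_dweight t : dom t -> continuous dweight t.
Proof.
intros [H1 H2]; apply differentiable_continuous; unfold dweight; auto_derive.
repeat split; try nra.
Qed.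

Lemma RInt_dweight a b : dom a -> dom b -> a <= b ->
  is_RInt dweight a b (weight b - weight a).
Proof.
intros Ha Hb Hab; apply (is_RInt_derive weight dweight);
rewrite Rmin_left, Rmax_right by lra; intros x Hx;
[apply is_derive_weight | apply continuous_dweight];
apply (dom_le _ b Hb); destruct Ha; lra.
Qed.

Lemma dweight_ge0 t : dom t -> 0 <= dweight t.
Proof.
intros [H1 H2]; unfold dweight; apply Rplus_le_le_0_compat;
apply Rmult_le_pos; try nra;
apply Rlt_le, Rinv_0_lt_compat; nra.
Qed.

Lemma weight_ge0 t : dom t -> 0 <= weight t.
Proof.
intros [H1 H2]; unfold weight; apply Rmult_le_pos.
- apply pow_le; lra.
- apply Rlt_le, Rinv_0_lt_compat; nra.
Qed.

(* Source of the contraction factor 2/3 of the iteration. *)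
Lemma coupling_weight t : dom t ->
  coupling t * (2 * weight t) <= 2 / 3 * dweight t.
Proof.
intros [H1 H2]; unfold coupling, weight, dweight.
destruct (Req_dec t 0) as [->|H0].
- right; unfold Rdiv; rewrite !pow_i by lia; ring.
- apply Rminus_le; set (d := 1 - 2 * t ^ 2).
  replace (_ - _) with (- ((2 / 3) * t ^ 4 * / d ^ 2)).
  + assert (0 <= t ^ 4 * / d ^ 2); [|lra].
    apply Rmult_le_pos; [apply pow_le; lra|].
    apply Rlt_le, Rinv_0_lt_compat, pow_lt; unfold d; lra.
  + unfold d; field; split; nra.
Qed.

Lemma coupling_ge0 t : 0 < t -> dom t -> 0 <= coupling t.
Proof.
intros H [H1 H2]; unfold coupling; apply Rplus_le_le_0_compat.
- apply Rlt_le, Rinv_0_lt_compat; lra.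
- apply Rmult_le_pos; [lra | apply Rlt_le, Rinv_0_lt_compat; lra].
Qed.

Lemma continuous_coupling t : 0 < t -> dom t -> continuous coupling t.
Proof.
intros H [H1 H2]; apply differentiable_continuous; unfold coupling; auto_derive.
repeat split; nra.
Qed.

(* k as a function of the density. *)
Definition cone (r : R) : R := RInt speed 0 r.

Lemma dom0 : dom 0.
Proof. split; lra. Qed.

Lemma continuous_speed t : dom t -> continuous speed t.
Proof.
intros [H1 H2]; unfold speed, Rdiv.
apply (continuous_mult (fun t => sqrt (1 - 2 * t ^ 2)) (fun t => / (1 - t ^ 2))).
- apply (continuous_comp (fun t => 1 - 2 * t ^ 2) sqrt).
  + apply differentiable_continuous; auto_derive; trivial.
  + apply continuous_sqrt.
- apply differentiable_continuous; auto_derive; nra.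
Qed.

(** The upper bound makes [cone] 1-Lipschitz, so displacements along characteristics are controlled
    by increments of the density. It amounts to 1 - 2 t^2 <= (1 - t^2)^2. *)
Lemma speed_bounds t : dom t -> 0 <= speed t <= 1.
Proof.
intros [H1 H2]; unfold speed.
assert (Hi : 0 < / (1 - t ^ 2)) by (apply Rinv_0_lt_compat; nra).
split.
- apply Rmult_le_pos; [apply sqrt_pos | lra].
- apply Rmult_le_reg_r with (1 - t ^ 2); [nra|].
  unfold Rdiv; rewrite Rmult_assoc, Rinv_l, Rmult_1_r, Rmult_1_l by nra.
  rewrite <- (sqrt_Rsqr (1 - t ^ 2)) by nra.
  apply sqrt_le_1_alt; unfold Rsqr; nra.
Qed.

Lemma continuous_dom_speed : continuous_dom speed.
Proof. exact (continuous_dom_continuous _ continuous_speed). Qed.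

Lemma cone0 : cone 0 = 0.
Proof. exact (RInt_point 0 speed). Qed.

Lemma RInt_split F a b c : ex_RInt F a b -> ex_RInt F b c ->
  RInt F a c = RInt F a b + RInt F b c.
Proof. intros H1 H2; symmetry; exact (RInt_Chasles F a b c H1 H2). Qed.

Lemma cone_incr y x : dom y -> dom x -> y <= x ->
  0 <= cone x - cone y <= x - y.
Proof.
intros Hy Hx Hyx.
assert (H : forall a b, dom a -> dom b -> a <= b -> ex_RInt speed a b)
  by (intros; apply ex_RInt_dom; auto using continuous_dom_speed).
assert (E : cone x = cone y + RInt speed y x)
  by (apply (RInt_split speed); apply H; auto using dom0, dom_ge0).
assert (E' : cone x - cone y = RInt speed y x) by (rewrite E; simpl; lra).
rewrite E'.
split.
- apply RInt_ge_0; auto; intros t Ht; apply speed_bounds.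
  apply (dom_le _ x Hx); destruct Hy; lra.
- rewrite <- (Rmult_1_r (x - y)).
  apply Rle_trans with (1 := Rle_abs _), abs_RInt_le_const; auto.
  intros t Ht; assert (Hd : dom t) by (apply (dom_le _ x Hx); destruct Hy; lra).
  generalize (speed_bounds t Hd); intros; apply Rabs_le; lra.
Qed.

Lemma cone_lip y x : dom y -> dom x -> Rabs (cone x - cone y) <= Rabs (x - y).
Proof.
intros Hy Hx; destruct (Rle_dec y x) as [H|H].
- generalize (cone_incr y x Hy Hx H); intros; rewrite !Rabs_pos_eq; lra.
- assert (H' : x <= y) by lra.
  generalize (cone_incr x y Hx Hy H'); intros.
  rewrite (Rabs_minus_sym _ (cone y)), (Rabs_minus_sym _ y).
  rewrite !Rabs_pos_eq; lra.
Qed.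

Lemma is_derive_RInt_dom F r : continuous_dom F -> 0 < r -> dom r ->
  is_derive (fun x => RInt F 0 x) r (F r).
Proof.
intros HF Hr Hd; apply (is_derive_RInt F (fun x => RInt F 0 x) 0).
- apply (filter_imp (fun x => 0 < x /\ dom x)).
  + intros x [Hx0 Hx]; apply (RInt_correct F), ex_RInt_dom; auto using dom0; lra.
  + now apply dom_locally.
- now apply continuous_continuous_dom.
Qed.

(** * Transport along one family of characteristics *)

Definition blip (g : R -> R) : Prop :=
  exists B L, (forall x, Rabs (g x) <= B) /\
    (forall x y, Rabs (g x - g y) <= L * Rabs (x - y)).

Definition shift (g : R -> R) (s : R) : R -> R := fun x => g (x + s).

Lemma blip_shift g s : blip g -> blip (shift g s).
Proof.
intros [B [L [H1 H2]]]; exists B, L; unfold shift; split; intros; auto.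
replace (x - y) with ((x + s) - (y + s)) by ring; auto.
Qed.

Lemma blip_lin a b g h : blip g -> blip h ->
  blip (fun x => a * g x + b * h x).
Proof.
intros [B [L [H1 H2]]] [B' [L' [H1' H2']]].
exists (Rabs a * B + Rabs b * B'), (Rabs a * L + Rabs b * L'); split.
- intros x; apply Rle_trans with (1 := Rabs_triang _ _); rewrite !Rabs_mult.
  apply Rplus_le_compat; apply Rmult_le_compat_l; auto using Rabs_pos.
- intros x y; replace (_ - _) with (a * (g x - g y) + b * (h x - h y)) by ring.
  apply Rle_trans with (1 := Rabs_triang _ _); rewrite !Rabs_mult.
  rewrite Rmult_plus_distr_r, !Rmult_assoc.
  apply Rplus_le_compat; apply Rmult_le_compat_l; auto using Rabs_pos.
Qed.

(** Functionals of order zero on bounded Lipschitz functions, a class closed under translation that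
    contains all derivatives of test functions. The sup bound survives translation, so iterating
    loses no regularity; Lipschitz constants enter only the moduli in the density. The bound carries
    [dweight] because integrating it along a characteristic yields [weight]. *)
Record admissible (Psi : R -> (R -> R) -> R) (C : R) : Prop := {
  adm_lin : forall t a b g h, dom t -> blip g -> blip h ->
    Psi t (fun x => a * g x + b * h x) = a * Psi t g + b * Psi t h;
  adm_bound : forall t g B, dom t -> blip g -> (forall x, Rabs (g x) <= B) ->
    Rabs (Psi t g) <= C * B * dweight t;
  adm_cont : forall g, blip g -> continuous_dom (fun t => Psi t g);
  adm_supp : forall t g a, dom t -> blip g -> cone t < a ->
    (forall x, Rabs x < a -> g x = 0) -> Psi t g = 0 }.

(* Value at s = 0 of the solution of (d/dr - e k_r d/ds) v = Psi with zero data, where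
   e = 1 or -1 selects the family of characteristics. *)
Definition volterra (e : R) (Psi : R -> (R -> R) -> R) (r : R) (g : R -> R) : R :=
  RInt (fun t => Psi t (shift g (e * (cone r - cone t)))) 0 r.

Section Volterra.

Variables (e : R) (Psi : R -> (R -> R) -> R) (C : R).
Hypotheses (He : Rabs e = 1) (HPsi : admissible Psi C).

Lemma adm_sub t g h : dom t -> blip g -> blip h ->
  Psi t g - Psi t h = Psi t (fun x => 1 * g x + -1 * h x).
Proof. intros; rewrite (adm_lin _ _ HPsi) by auto; ring. Qed.

Lemma shift_diff g L s s' :
  (forall x y, Rabs (g x - g y) <= L * Rabs (x - y)) ->
  forall x, Rabs (1 * shift g s x + -1 * shift g s' x) <= L * Rabs (s - s').
Proof.
intros H x; unfold shift.
replace (_ + _) with (g (x + s) - g (x + s')) by ring.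
replace (s - s') with ((x + s) - (x + s')) by ring; auto.
Qed.

(** Functional and argument both move with [t]. Moving the functional at a fixed argument is
    [adm_cont]; moving the argument costs the Lipschitz constant of [g] times the displacement of
    the cone, by linearity and the sup bound. *)
Lemma continuous_dom_integrand g kappa : blip g ->
  continuous_dom (fun t => Psi t (shift g (e * (kappa - cone t)))).
Proof.
intros Hg t Ht eps Heps.
pose proof Hg as [B [L [HB HL]]].
set (gt := shift g (e * (kappa - cone t))).
assert (Hgt : blip gt) by now apply blip_shift.
destruct (adm_cont _ _ HPsi gt Hgt t Ht (eps / 2)) as [d1 [Hd1 H1]]; [lra|].
destruct (continuous_dom_continuous _ continuous_dweight t Ht 1)
  as [d2 [Hd2 H2]]; [lra|].
(* For [t'] close to [t], [dweight t'] is at most [dweight t + 1]. *)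
set (M := Rabs (C * L * (dweight t + 1))).
assert (HM : 0 <= M) by apply Rabs_pos.
assert (Hd3 : 0 < eps / (2 * (M + 1))) by (apply Rdiv_lt_0_compat; lra).
exists (Rmin d1 (Rmin d2 (eps / (2 * (M + 1))))); split;
  [repeat apply Rmin_pos; auto|].
intros t' Ht' Htt'.
assert (Htt1 := Rlt_le_trans _ _ _ Htt' (Rmin_l _ _)).
assert (Htt23 := Rlt_le_trans _ _ _ Htt' (Rmin_r _ _)).
assert (Htt2 := Rlt_le_trans _ _ _ Htt23 (Rmin_l _ _)).
assert (Htt3 := Rlt_le_trans _ _ _ Htt23 (Rmin_r _ _)).
specialize (H1 t' Ht' Htt1); specialize (H2 t' Ht' Htt2).
set (gt' := shift g (e * (kappa - cone t'))).
assert (Hgt' : blip gt') by now apply blip_shift.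
replace (Psi t' gt' - Psi t gt)
  with ((Psi t' gt' - Psi t' gt) + (Psi t' gt - Psi t gt)) by ring.
apply Rle_lt_trans with (1 := Rabs_triang _ _).
enough (Rabs (Psi t' gt' - Psi t' gt) <= eps / 2) by lra.
rewrite adm_sub by auto.
assert (Hs : forall x, Rabs (1 * gt' x + -1 * gt x) <= L * Rabs (t' - t)).
{ intros x; apply Rle_trans with (1 := shift_diff g L _ _ HL x).
  assert (HL0 : 0 <= L).
  { generalize (HL 1 0), (Rabs_pos (g 1 - g 0)).
    rewrite Rminus_0_r, Rabs_R1; lra. }
  apply Rmult_le_compat_l; auto.
  replace (_ - _) with (- e * (cone t' - cone t)) by ring.
  rewrite Rabs_mult, Rabs_Ropp, He, Rmult_1_l; now apply cone_lip. }
apply Rle_trans with (1 := adm_bound _ _ HPsi t' _ _ Ht' (blip_lin _ _ _ _ Hgt' Hgt) Hs).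
apply Rle_trans with (M * Rabs (t' - t)).
- replace (C * _ * _) with (C * L * dweight t' * Rabs (t' - t)) by ring.
  apply Rmult_le_compat_r; [apply Rabs_pos|].
  apply Rle_trans with (1 := Rle_abs _); unfold M; rewrite !(Rabs_mult (C * L)).
  apply Rmult_le_compat_l; [apply Rabs_pos|].
  apply Rabs_def2 in H2; generalize (dweight_ge0 t Ht), (dweight_ge0 t' Ht').
  intros; rewrite !Rabs_pos_eq; lra.
- assert (HE : eps / 2 = (M + 1) * (eps / (2 * (M + 1)))) by (field; lra).
  rewrite HE; apply Rmult_le_compat; try lra; apply Rabs_pos.
Qed.

Lemma ex_RInt_integrand g kappa a b : blip g -> dom a -> dom b -> a <= b ->
  ex_RInt (fun t => Psi t (shift g (e * (kappa - cone t)))) a b.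
Proof. intros Hg Ha Hb Hab; apply ex_RInt_dom; auto using continuous_dom_integrand. Qed.

Lemma RInt_integrand_le g B kappa a b : blip g -> (forall x, Rabs (g x) <= B) ->
  dom a -> dom b -> a <= b ->
  Rabs (RInt (fun t => Psi t (shift g (e * (kappa - cone t)))) a b)
  <= C * B * (weight b - weight a).
Proof.
intros Hg HB Ha Hb Hab.
assert (HR := is_RInt_scal _ _ _ (C * B) _ (RInt_dweight a b Ha Hb Hab)).
change (is_RInt (fun t => C * B * dweight t) a b (C * B * (weight b - weight a))) in HR.
rewrite <- (is_RInt_unique _ _ _ _ HR).
apply abs_RInt_le_dom; auto using continuous_dom_integrand.
- eexists; exact HR.
- intros t Ht; apply (adm_bound _ _ HPsi); auto using blip_shift.
  + apply (dom_le _ b Hb); destruct Ha; lra.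
  + intros x; apply HB.
Qed.

Lemma weight0 : weight 0 = 0.
Proof. unfold weight; field. Qed.

Lemma volterra_bound r g B : dom r -> blip g -> (forall x, Rabs (g x) <= B) ->
  Rabs (volterra e Psi r g) <= C * B * weight r.
Proof.
intros Hr Hg HB.
replace (weight r) with (weight r - weight 0) by (rewrite weight0; ring).
apply RInt_integrand_le; auto using dom0; apply Hr.
Qed.

Lemma volterra_lin r a b g h : dom r -> blip g -> blip h ->
  volterra e Psi r (fun x => a * g x + b * h x)
  = a * volterra e Psi r g + b * volterra e Psi r h.
Proof.
intros Hr Hg Hh; unfold volterra.
apply is_RInt_unique.
apply (is_RInt_ext (fun t =>
  plus (scal a (Psi t (shift g (e * (cone r - cone t)))))
       (scal b (Psi t (shift h (e * (cone r - cone t))))))).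
- rewrite Rmin_left, Rmax_right by apply Hr; intros t Ht.
  symmetry; apply (adm_lin _ _ HPsi t a b (shift g _) (shift h _));
    try (now apply blip_shift).
  apply (dom_le _ r Hr); lra.
- apply (is_RInt_plus (V := R_NormedModule));
  apply (is_RInt_scal (V := R_NormedModule)), (RInt_correct (V := R_CompleteNormedModule));
  apply ex_RInt_integrand; auto using dom0; apply Hr.
Qed.

Lemma shift_shift g a b : shift (shift g a) b = shift g (a + b).
Proof.
apply functional_extensionality; intros x; unfold shift; f_equal; ring.
Qed.

(** Evolution property: what has accumulated up to [y] is transported freely to [x], which only
    translates the test function, and the source adds the integral from [y] to [x]. *)
Lemma volterra_step y x g : dom y -> dom x -> y <= x -> blip g ->
  volterra e Psi x g = volterra e Psi y (shift g (e * (cone x - cone y)))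
    + RInt (fun t => Psi t (shift g (e * (cone x - cone t)))) y x.
Proof.
intros Hy Hx Hyx Hg; unfold volterra at 1.
rewrite (RInt_split _ 0 y x)
  by (apply ex_RInt_integrand; auto using dom0; apply Hy).
f_equal; apply RInt_ext; intros t _.
rewrite shift_shift; do 2 f_equal; ring.
Qed.

Lemma volterra_shift r g L s s' : dom r -> blip g ->
  (forall x y, Rabs (g x - g y) <= L * Rabs (x - y)) ->
  Rabs (volterra e Psi r (shift g s) - volterra e Psi r (shift g s'))
  <= C * (L * Rabs (s - s')) * weight r.
Proof.
intros Hr Hg HL.
replace (_ - _) with
  (volterra e Psi r (fun x => 1 * shift g s x + -1 * shift g s' x))
  by (rewrite volterra_lin by auto using blip_shift; ring).
apply volterra_bound; auto using blip_lin, blip_shift.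
now apply shift_diff.
Qed.

Lemma shift0 g : shift g 0 = g.
Proof.
apply functional_extensionality; intros x; unfold shift; f_equal; ring.
Qed.

Lemma volterra_mod y x g B L : 0 <= C -> 0 <= L -> dom y -> dom x -> y <= x -> blip g ->
  (forall x, Rabs (g x) <= B) ->
  (forall x y, Rabs (g x - g y) <= L * Rabs (x - y)) ->
  Rabs (volterra e Psi x g - volterra e Psi y g)
  <= C * L * (x - y) * weight y + C * B * (weight x - weight y).
Proof.
intros HC HL0 Hy Hx Hyx Hg HB HL.
rewrite (volterra_step y x) by auto.
assert (E : volterra e Psi y g = volterra e Psi y (shift g 0))
  by now rewrite shift0.
rewrite E; clear E.
set (i := RInt _ _ _).
replace (_ - _) with (volterra e Psi y (shift g (e * (cone x - cone y)))
  - volterra e Psi y (shift g 0) + i) by ring.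
apply Rle_trans with (1 := Rabs_triang _ _), Rplus_le_compat.
- apply Rle_trans with (1 := volterra_shift _ _ L _ _ Hy Hg HL).
  apply Rmult_le_compat_r; [now apply weight_ge0|].
  rewrite Rmult_assoc; apply Rmult_le_compat_l; auto.
  apply Rmult_le_compat_l; auto.
  rewrite Rminus_0_r, Rabs_mult, He, Rmult_1_l.
  rewrite <- (Rabs_pos_eq (x - y)) by lra; now apply cone_lip.
- now apply RInt_integrand_le.
Qed.

Lemma continuous_dom_volterra g : 0 <= C -> blip g ->
  continuous_dom (fun r => volterra e Psi r g).
Proof.
intros HC Hg t Ht eps Heps.
pose proof Hg as [B [L [HB HL]]].
assert (HL0 : 0 <= L).
{ generalize (HL 1 0), (Rabs_pos (g 1 - g 0)).
  rewrite Rminus_0_r, Rabs_R1; lra. }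
assert (HB0 : 0 <= B) by (generalize (HB 0), (Rabs_pos (g 0)); lra).
assert (Hw : continuous_dom weight).
{ apply continuous_dom_continuous; intros z Hz; apply differentiable_continuous.
  eexists; now apply is_derive_weight. }
set (M := C * L * (weight t + 1) + C * B).
generalize (weight_ge0 t Ht); intros Hwt.
assert (HM : 0 <= M).
{ unfold M; apply Rplus_le_le_0_compat; repeat apply Rmult_le_pos; lra. }
assert (Hp : 0 < eps / (M + 1)) by (apply Rdiv_lt_0_compat; lra).
destruct (Hw t Ht (Rmin 1 (eps / (M + 1)))) as [d [Hd H]];
  [apply Rmin_pos; lra|].
exists (Rmin d (eps / (M + 1))); split; [now apply Rmin_pos|].
intros t' Ht' Htt'.
assert (Hd1 := Rlt_le_trans _ _ _ Htt' (Rmin_l _ _)).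
assert (Hd2 := Rlt_le_trans _ _ _ Htt' (Rmin_r _ _)).
assert (Hw1 := Rlt_le_trans _ _ _ (H t' Ht' Hd1) (Rmin_l _ _)).
assert (Hw2 := Rlt_le_trans _ _ _ (H t' Ht' Hd1) (Rmin_r _ _)).
set (d' := eps / (M + 1)) in *.
assert (HE : eps = (M + 1) * d') by (unfold d'; field; lra).
apply Rle_lt_trans with (M * d'); [|nra].
assert (Hgen : forall y x, dom y -> dom x -> y <= x -> weight y <= weight t + 1 ->
  x - y <= d' -> weight x - weight y <= d' ->
  Rabs (volterra e Psi x g - volterra e Psi y g) <= M * d').
{ intros y x Hy Hx Hyx H1 H2 H3.
  apply Rle_trans with (1 := volterra_mod y x g B L HC HL0 Hy Hx Hyx Hg HB HL).
  unfold M; rewrite Rmult_plus_distr_r; apply Rplus_le_compat.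
  - replace (C * L * (x - y) * weight y) with (C * L * (weight y * (x - y))) by ring.
    rewrite (Rmult_assoc (C * L)); apply Rmult_le_compat_l; [now apply Rmult_le_pos|].
    apply Rmult_le_compat; try lra; now apply weight_ge0.
  - apply Rmult_le_compat_l; [now apply Rmult_le_pos | lra]. }
apply Rabs_def2 in Hw1; apply Rabs_def2 in Hw2; apply Rabs_def2 in Hd2.
destruct (Rle_dec t t') as [Hle|Hle].
- apply Hgen; auto; lra.
- rewrite Rabs_minus_sym; apply Hgen; auto; lra.
Qed.

(** Finite speed of propagation: at density [t] the translated function still vanishes for |x| < a -
    (cone r - cone t), a radius that exceeds [cone t] because [cone r < a]. *)
Lemma volterra_supp r g a : dom r -> blip g -> cone r < a ->
  (forall x, Rabs x < a -> g x = 0) -> volterra e Psi r g = 0.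
Proof.
intros Hr Hg Ha H; unfold volterra.
rewrite (RInt_ext _ (fun _ => 0)).
- rewrite RInt_const; apply Rmult_0_r.
- rewrite Rmin_left, Rmax_right by apply Hr; intros t Ht.
  assert (Hd : dom t) by (apply (dom_le _ r Hr); lra).
  destruct (cone_incr t r Hd Hr) as [Hc _]; [lra|].
  apply (adm_supp _ _ HPsi _ _ (a - (cone r - cone t)));
    auto using blip_shift; [lra|].
  intros x Hx; apply H.
  apply Rle_lt_trans with (1 := Rabs_triang _ _).
  rewrite Rabs_mult, He, Rmult_1_l, (Rabs_pos_eq (cone r - cone t)); lra.
Qed.

End Volterra.

(** Increments are ordered from left to right because [volterra_step] needs [y <= x]; letting [r] be
    either endpoint treats both one-sided derivatives in a single estimate. *)
Lemma is_derive_two_point f r l :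
  (forall eps, 0 < eps -> exists delta, 0 < delta /\
     forall y x, y <= x -> y = r \/ x = r -> x - y < delta ->
       Rabs (f x - f y - l * (x - y)) <= eps * (x - y)) ->
  is_derive f r l.
Proof.
intros H; apply is_derive_Reals; intros eps Heps.
destruct (H (eps / 2)) as [d [Hd Hf]]; [lra|].
exists (mkposreal _ Hd); intros h Hh Hhd; simpl in Hhd.
replace (_ / h - l) with ((f (r + h) - f r - l * h) / h) by (now field).
unfold Rdiv; rewrite Rabs_mult, Rabs_inv.
assert (Hh0 : 0 < Rabs h) by now apply Rabs_pos_lt.
apply Rmult_lt_reg_r with (Rabs h); auto.
rewrite Rmult_assoc, Rinv_l, Rmult_1_r by lra.
apply Rle_lt_trans with (eps / 2 * Rabs h); [|nra].
destruct (Rle_dec 0 h) as [Hs|Hs].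
- rewrite (Rabs_pos_eq h) in * by lra.
  replace (l * h) with (l * (r + h - r)) by ring.
  replace (eps / 2 * h) with (eps / 2 * (r + h - r)) by ring.
  apply Hf; auto; lra.
- rewrite (Rabs_left h) in * by lra; rewrite <- Rabs_Ropp.
  replace (- (_ - _)) with (f r - f (r + h) - l * (r - (r + h))) by ring.
  replace (eps / 2 * - h) with (eps / 2 * (r - (r + h))) by ring.
  apply Hf; auto; lra.
Qed.

Lemma two_point_is_derive f r l : is_derive f r l ->
  forall eps, 0 < eps -> exists delta, 0 < delta /\
     forall y x, y <= x -> y = r \/ x = r -> x - y < delta ->
       Rabs (f x - f y - l * (x - y)) <= eps * (x - y).
Proof.
intros H eps Heps; apply is_derive_Reals in H.
destruct (H eps Heps) as [d Hd]; exists d; split; [apply cond_pos|].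
assert (Hh : forall h, Rabs h < d -> Rabs (f (r + h) - f r - l * h) <= eps * Rabs h).
{ intros h Hhd; destruct (Req_dec h 0) as [->|Hh].
  - rewrite Rplus_0_r, Rabs_R0.
    replace (_ - _) with 0 by ring; rewrite Rabs_R0; lra.
  - specialize (Hd h Hh Hhd).
    replace (f (r + h) - f r - l * h) with (((f (r + h) - f r) / h - l) * h)
      by (now field).
    rewrite Rabs_mult; apply Rmult_le_compat_r; [apply Rabs_pos | lra]. }
intros y x Hyx [->| ->] Hd'.
- specialize (Hh (x - r)); rewrite Rabs_pos_eq in Hh by lra.
  replace (r + (x - r)) with x in Hh by ring; apply Hh; lra.
- specialize (Hh (y - r)); rewrite (Rabs_left1 (y - r)) in Hh by lra.
  replace (r + (y - r)) with y in Hh by ring; rewrite <- Rabs_Ropp.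
  replace (- (f r - f y - l * (r - y))) with (f y - f r - l * (y - r)) by ring.
  replace (r - y) with (- (y - r)) by ring; apply Hh; lra.
Qed.

Lemma is_derive_cone r : 0 < r -> dom r -> is_derive cone r (speed r).
Proof. intros Hr Hd; apply (is_derive_RInt_dom speed); auto using continuous_dom_speed. Qed.

(** The remainder is uniform in the base point, so that it can be fed to the sup bound of a
    functional. *)
Definition taylor2 (g g1 : R -> R) (M : R) : Prop :=
  forall x s, Rabs (g (x + s) - g x - s * g1 x) <= M * s ^ 2.

(** After [volterra_step] four errors remain over [y, x]: the Taylor remainder of the translation
    (T1), the continuity of the transported [g1] (T2), the differentiability of [cone] (T3) and the
    averaging of the source (T4). *)
Lemma is_derive_volterra e Psi C r g g1 M : Rabs e = 1 -> admissible Psi C ->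
  0 <= C -> 0 < r -> dom r -> blip g -> blip g1 -> taylor2 g g1 M ->
  is_derive (fun r => volterra e Psi r g) r
    (e * speed r * volterra e Psi r g1 + Psi r g).
Proof.
intros He HPsi HC Hr Hd Hg Hg1 HM.
pose proof Hg as [B [L [HB HL]]].
assert (HL0 : 0 <= L).
{ generalize (HL 1 0), (Rabs_pos (g 1 - g 0)).
  rewrite Rminus_0_r, Rabs_R1; lra. }
assert (HM0 : 0 <= M).
{ generalize (HM 0 1), (Rabs_pos (g (0 + 1) - g 0 - 1 * g1 0)).
  replace (1 ^ 2) with 1 by ring; lra. }
set (v1 := volterra e Psi r g1).
(* Sum of the constants of T1 to T4; the values at [r] increased by 1 bound the nearby values of
   [weight] and [dweight]. *)
set (CE := C * M * (weight r + 1) + 1 + Rabs v1 + C * L * (dweight r + 1) + 1).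
generalize (weight_ge0 r Hd), (dweight_ge0 r Hd), (Rabs_pos v1); intros Hw Hdw Hv.
assert (HCE : 0 < CE).
{ assert (0 <= C * M) by now apply Rmult_le_pos.
  assert (0 <= C * L) by now apply Rmult_le_pos.
  unfold CE; nra. }
apply is_derive_two_point; intros eps Heps.
set (eta := eps / CE).
assert (Heta : 0 < eta) by now apply Rdiv_lt_0_compat.
assert (Ecap : eps = CE * eta) by (unfold eta; field; lra).
assert (Hwc : continuous_dom weight).
{ apply continuous_dom_continuous; intros z Hz; apply differentiable_continuous.
  eexists; now apply is_derive_weight. }
destruct (dom_locally r Hr Hd) as [d0 H0].
destruct (Hwc r Hd 1) as [d1 [Hd1 H1]]; [lra|].
destruct (continuous_dom_continuous _ continuous_dweight r Hd 1) as [d2 [Hd2 H2]]; [lra|].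
destruct (continuous_dom_volterra e Psi C He HPsi g1 HC Hg1 r Hd eta Heta) as [d3 [Hd3 H3]].
destruct (adm_cont _ _ HPsi g Hg r Hd eta Heta) as [d4 [Hd4 H4]].
destruct (two_point_is_derive _ _ _ (is_derive_cone r Hr Hd) eta Heta) as [d5 [Hd5 H5]].
(* The entry [eta] makes the quadratic error of T1 at most a constant times [eta * (x - y)], and the
   displacement in T4 at most [eta]. *)
exists (Rmin d0 (Rmin d1 (Rmin d2 (Rmin d3 (Rmin d4 (Rmin d5 eta)))))); split.
{ repeat apply Rmin_pos; auto; apply cond_pos. }
intros y x Hyx Hor Hdel.
repeat match goal with H : _ < Rmin _ _ |- _ =>
  let H' := fresh in pose proof (Rlt_le_trans _ _ _ H (Rmin_l _ _)) as H';
  apply Rlt_le_trans with (2 := Rmin_r _ _) in H end.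
assert (Hnear : forall t, y <= t <= x -> Rabs (t - r) <= x - y)
  by (intros t Ht; apply Rabs_le; destruct Hor as [E|E]; rewrite <- E; lra).
assert (Hdom : forall t, y <= t <= x -> dom t).
{ intros t Ht; apply (H0 t); change (Rabs (t - r) < d0).
  generalize (Hnear t Ht); lra. }
assert (Hy := Hdom y (conj (Rle_refl _) Hyx)).
assert (Hx := Hdom x (conj Hyx (Rle_refl _))).
assert (Hny := Hnear y (conj (Rle_refl _) Hyx)).
rewrite (volterra_step e Psi C He HPsi y x) by auto.
set (del := cone x - cone y).
assert (Hdelta : 0 <= del <= x - y) by now apply cone_incr.
set (I := RInt _ _ _).
assert (T1 : Rabs (volterra e Psi y (shift g (e * del)) - volterra e Psi y g
   - e * del * volterra e Psi y g1) <= C * M * (weight r + 1) * eta * (x - y)).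
{ set (g2 := fun x => 1 * shift g (e * del) x + -1 * g x).
  assert (Hg2 : blip g2) by (apply blip_lin; auto using blip_shift).
  replace (_ - _) with (volterra e Psi y (fun x => 1 * g2 x + (- (e * del)) * g1 x)).
  2:{ rewrite (volterra_lin _ _ _ He HPsi) by auto.
      unfold g2; rewrite (volterra_lin _ _ _ He HPsi) by auto using blip_shift; ring. }
  apply Rle_trans with (C * (M * del ^ 2) * weight y).
  - apply (volterra_bound _ _ _ He HPsi); auto using blip_lin.
    intros z; unfold g2, shift.
    replace (del ^ 2) with ((e * del) ^ 2).
    + replace (_ + _) with (g (z + e * del) - g z - e * del * g1 z) by ring; apply HM.
    + rewrite Rpow_mult_distr, <- (pow2_abs e), He; ring.
  - assert (Hwy : weight y <= weight r + 1).
    { specialize (H1 y Hy); apply Rabs_def2 in H1; lra. }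
    assert (Hd2' : del ^ 2 <= eta * (x - y)) by nra.
    replace (C * M * (weight r + 1) * eta * (x - y))
      with (C * (M * (eta * (x - y))) * (weight r + 1)) by ring.
    assert (0 <= del ^ 2) by (apply pow2_ge_0).
    assert (0 <= weight y) by now apply weight_ge0.
    apply Rmult_le_compat; auto.
    + apply Rmult_le_pos, Rmult_le_pos; auto.
    + repeat apply Rmult_le_compat_l; auto. }
assert (T2 : Rabs (e * del * (volterra e Psi y g1 - v1)) <= 1 * eta * (x - y)).
{ rewrite !Rabs_mult, He, (Rabs_pos_eq del) by lra.
  assert (Rabs (volterra e Psi y g1 - v1) < eta) by (apply H3; auto; lra).
  generalize (Rabs_pos (volterra e Psi y g1 - v1)); intros; nra. }
assert (T3 : Rabs (e * (del - speed r * (x - y)) * v1) <= Rabs v1 * eta * (x - y)).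
{ rewrite !Rabs_mult, He, Rmult_1_l, Rmult_comm, Rmult_assoc.
  apply Rmult_le_compat_l; auto; apply H5; auto; lra. }
assert (T4 : Rabs (I - Psi r g * (x - y)) <= (C * L * (dweight r + 1) + 1) * eta * (x - y)).
{ set (F := fun t => Psi t (shift g (e * (cone x - cone t)))).
  assert (HF : continuous_dom F) by (apply (continuous_dom_integrand e Psi C); auto).
  assert (E : I - Psi r g * (x - y) = RInt (fun t => minus (F t) (Psi r g)) y x).
  { symmetry; apply is_RInt_unique.
    replace (Psi r g * (x - y)) with (scal (x - y) (Psi r g)) by apply Rmult_comm.
    apply (is_RInt_minus F (fun _ => Psi r g)).
    - apply (RInt_correct F), ex_RInt_dom; auto.
    - apply (is_RInt_const (V := R_NormedModule)). }
  rewrite E; rewrite (Rmult_comm _ (x - y)).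
  apply abs_RInt_le_const; auto.
  - apply (ex_RInt_minus F (fun _ => Psi r g)).
    + apply ex_RInt_dom; auto.
    + apply (ex_RInt_const (V := R_NormedModule)).
  - intros t Ht; change (minus (F t) (Psi r g)) with (F t - Psi r g).
    assert (Hnt := Hnear t Ht); assert (Hdt := Hdom t Ht).
    replace (F t - Psi r g) with ((F t - Psi t g) + (Psi t g - Psi r g)) by ring.
    apply Rle_trans with (1 := Rabs_triang _ _).
    rewrite Rmult_plus_distr_r; apply Rplus_le_compat.
    + assert (E0 : Psi t g = Psi t (shift g 0)) by now rewrite shift0.
      unfold F; rewrite E0, (adm_sub _ _ HPsi) by auto using blip_shift.
      set (s := e * (cone x - cone t)).
      apply Rle_trans with (C * (L * Rabs (s - 0)) * dweight t).
      * apply (adm_bound _ _ HPsi); auto using blip_lin, blip_shift.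
        intros z; apply (shift_diff g L s 0 HL z).
      * assert (Hs : Rabs (s - 0) <= eta).
        { unfold s; rewrite Rminus_0_r, Rabs_mult, He, Rmult_1_l.
          apply Rle_trans with (1 := cone_lip t x Hdt Hx); apply Rabs_le; lra. }
        assert (Hdw' : dweight t <= dweight r + 1).
        { specialize (H2 t Hdt); apply Rabs_def2 in H2; lra. }
        replace (C * L * (dweight r + 1) * eta) with (C * (L * eta) * (dweight r + 1)) by ring.
        assert (0 <= dweight t) by now apply dweight_ge0.
        apply Rmult_le_compat; auto.
        -- apply Rmult_le_pos, Rmult_le_pos; auto; apply Rabs_pos.
        -- repeat apply Rmult_le_compat_l; auto.
    + rewrite Rmult_1_l; apply Rlt_le, H4; auto; lra. }
set (vy := volterra e Psi y g1) in *.
replace (_ - _ - _) with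
  ((volterra e Psi y (shift g (e * del)) - volterra e Psi y g - e * del * vy)
   + e * del * (vy - v1) + e * (del - speed r * (x - y)) * v1
   + (I - Psi r g * (x - y))) by ring.
rewrite Ecap.
replace (CE * eta * (x - y)) with
  (C * M * (weight r + 1) * eta * (x - y) + 1 * eta * (x - y)
   + Rabs v1 * eta * (x - y) + (C * L * (dweight r + 1) + 1) * eta * (x - y))
  by (unfold CE; ring).
repeat (apply Rle_trans with (1 := Rabs_triang _ _), Rplus_le_compat; auto).
Qed.

(** * Summation of geometrically decaying admissible functionals *)

Section Sum.

Variables (Psi : nat -> R -> (R -> R) -> R) (C q : R).
Hypotheses (HC : 0 <= C) (Hq : 0 <= q < 1)
  (HPsi : forall n, admissible (Psi n) (C * q ^ n)).

(** Working with tails gives two things from one estimate: the full sum is [tail 0], and the decay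
    in [N] of the constant of [tail N] justifies both continuity in [t] and the exchange of sum and
    integral. *)
Definition tail (N : nat) (t : R) (g : R -> R) : R :=
  Series (fun n => Psi (N + n) t g).

Lemma term_bound N n t g B : dom t -> blip g -> (forall x, Rabs (g x) <= B) ->
  Rabs (Psi (N + n) t g) <= C * q ^ N * B * dweight t * q ^ n.
Proof.
intros Ht Hg HB.
apply Rle_trans with (1 := adm_bound _ _ (HPsi _) t g B Ht Hg HB).
right; rewrite pow_add; ring.
Qed.

Lemma ex_series_const_geom a : ex_series (fun n => a * q ^ n).
Proof.
apply (ex_series_scal_l a (fun n => q ^ n)), ex_series_geom.
rewrite Rabs_pos_eq; lra.
Qed.

Lemma ex_series_abs_terms N t g : dom t -> blip g ->
  ex_series (fun n => Rabs (Psi (N + n) t g)).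
Proof.
intros Ht Hg; pose proof Hg as [B [L [HB _]]].
apply (ex_series_le (V := R_CompleteNormedModule) _
  (fun n => C * q ^ N * B * dweight t * q ^ n)); [|apply ex_series_const_geom].
intros n; change norm with Rabs; rewrite Rabs_Rabsolu; now apply term_bound.
Qed.

Lemma ex_series_terms N t g : dom t -> blip g ->
  ex_series (fun n => Psi (N + n) t g).
Proof. intros; now apply ex_series_Rabs, ex_series_abs_terms. Qed.

Lemma tail_bound N t g B : dom t -> blip g -> (forall x, Rabs (g x) <= B) ->
  Rabs (tail N t g) <= C * q ^ N / (1 - q) * B * dweight t.
Proof.
intros Ht Hg HB.
apply Rle_trans with (1 := Series_Rabs _ (ex_series_abs_terms N t g Ht Hg)).
replace (_ * _) with (C * q ^ N * B * dweight t * Series (fun n => q ^ n)).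
2:{ rewrite Series_geom by (rewrite Rabs_pos_eq; lra); field; lra. }
rewrite <- Series_scal_l; apply Series_le; [|apply ex_series_const_geom].
intros n; split; [apply Rabs_pos | now apply term_bound].
Qed.

Lemma tail_step N t g : dom t -> blip g -> tail N t g = Psi N t g + tail (S N) t g.
Proof.
intros Ht Hg; unfold tail; rewrite Series_incr_1 by now apply ex_series_terms.
rewrite Nat.add_0_r; f_equal; apply Series_ext; intros n; f_equal; lia.
Qed.

Lemma tail_split g : blip g -> forall n N, exists S, continuous_dom S /\
  forall t, dom t -> tail N t g = S t + tail (n + N) t g.
Proof.
intros Hg n; induction n as [|n IH]; intros N.
- exists (fun _ => 0); split; [|intros; simpl; ring].
  apply continuous_dom_continuous; intros; apply continuous_const.
- destruct (IH (S N)) as [S1 [H1 H2]].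
  exists (fun t => 1 * Psi N t g + 1 * S1 t); split.
  + apply continuous_dom_lin; auto; now apply (adm_cont _ _ (HPsi N)).
  + intros t Ht; rewrite tail_step, H2 by auto.
    replace (n + S N)%nat with (S n + N)%nat by lia; ring.
Qed.

Lemma geom_small a eps : 0 <= a -> 0 < eps -> exists n, a * q ^ n < eps.
Proof.
intros Ha Heps.
destruct (pow_lt_1_zero q) with (y := eps / (a + 1)) as [n Hn];
  [rewrite Rabs_pos_eq; lra | apply Rdiv_lt_0_compat; lra |].
exists n; specialize (Hn n (Nat.le_refl _)).
assert (Hp : 0 <= q ^ n) by (apply pow_le; lra).
rewrite Rabs_pos_eq in Hn by auto.
assert (E : eps = (a + 1) * (eps / (a + 1))) by (field; lra).
set (c := eps / (a + 1)) in *; nra.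
Qed.

(** A continuous head plus a tail below eps/3; the tail is small uniformly near [t] since [dweight]
    is locally bounded. *)
Lemma tail_cont g N : blip g -> continuous_dom (fun t => tail N t g).
Proof.
intros Hg t Ht eps Heps; pose proof Hg as [B [L [HB _]]].
assert (HB0 : 0 <= B) by (generalize (HB 0), (Rabs_pos (g 0)); lra).
generalize (dweight_ge0 t Ht); intros Hw.
destruct (geom_small (C * q ^ N / (1 - q) * B * (dweight t + 1)) (eps / 3)) as [n Hn];
  [|lra|].
{ repeat apply Rmult_le_pos; try lra; [apply pow_le; lra|].
  apply Rlt_le, Rinv_0_lt_compat; lra. }
destruct (tail_split g Hg n N) as [S [HS E]].
destruct (HS t Ht (eps / 3)) as [d1 [Hd1 H1]]; [lra|].
destruct (continuous_dom_continuous _ continuous_dweight t Ht 1) as [d2 [Hd2 H2]]; [lra|].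
assert (Hs : forall t', dom t' -> dweight t' <= dweight t + 1 ->
  Rabs (tail (n + N) t' g) < eps / 3).
{ intros t' Ht' Hw'; apply Rle_lt_trans with (2 := Hn).
  apply Rle_trans with (1 := tail_bound (n + N) t' g B Ht' Hg HB).
  rewrite pow_add.
  replace (_ * (dweight t + 1) * q ^ n)
    with (C * (q ^ n * q ^ N) / (1 - q) * B * (dweight t + 1)) by (field; lra).
  apply Rmult_le_compat_l; auto.
  repeat apply Rmult_le_pos; try apply pow_le; try lra.
  apply Rlt_le, Rinv_0_lt_compat; lra. }
exists (Rmin d1 d2); split; [now apply Rmin_pos|]; intros t' Ht' Htt'.
specialize (H1 t' Ht' (Rlt_le_trans _ _ _ Htt' (Rmin_l _ _))).
specialize (H2 t' Ht' (Rlt_le_trans _ _ _ Htt' (Rmin_r _ _))).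
rewrite !E by auto.
assert (Ha := Hs t Ht); assert (Hb := Hs t' Ht').
apply Rabs_def2 in H2; apply Rabs_def2 in H1.
specialize (Ha ltac:(lra)); specialize (Hb ltac:(lra)).
apply Rabs_def2 in Ha; apply Rabs_def2 in Hb.
apply Rabs_def1; lra.
Qed.

Lemma admissible_tail N : admissible (tail N) (C * q ^ N / (1 - q)).
Proof.
split.
- intros t a b g h Ht Hg Hh; unfold tail.
  rewrite <- !Series_scal_l, <- Series_plus.
  + apply Series_ext; intros n; now apply (adm_lin _ _ (HPsi _)).
  + now apply (ex_series_scal_l a (fun n => Psi (N + n) t g)), ex_series_terms.
  + now apply (ex_series_scal_l b (fun n => Psi (N + n) t h)), ex_series_terms.
- intros; now apply tail_bound.
- intros; now apply tail_cont.
- intros t g a Ht Hg Ha H; unfold tail.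
  (* Written as [0 * 0], the zero series is evaluated by pulling out the factor 0. *)
  rewrite (Series_ext _ (fun n => 0 * 0)).
  + rewrite Series_scal_l; ring.
  + intros n; rewrite Rmult_0_l; now apply (adm_supp _ _ (HPsi _) _ _ a).
Qed.

Lemma volterra_tail_step e N r g : Rabs e = 1 -> dom r -> blip g ->
  volterra e (tail N) r g = volterra e (Psi N) r g + volterra e (tail (S N)) r g.
Proof.
intros He Hr Hg; unfold volterra; apply is_RInt_unique.
set (gt := fun t => shift g (e * (cone r - cone t))).
apply (is_RInt_ext (fun t => plus (Psi N t (gt t)) (tail (S N) t (gt t)))).
- rewrite Rmin_left, Rmax_right by apply Hr; intros t Ht.
  symmetry; apply tail_step; [apply (dom_le _ r Hr); lra | now apply blip_shift].
- apply (is_RInt_plus (V := R_NormedModule));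
  apply (RInt_correct (V := R_CompleteNormedModule)).
  + apply (ex_RInt_integrand e _ _ He (HPsi N)); auto using dom0, dom_ge0.
  + apply (ex_RInt_integrand e _ _ He (admissible_tail (S N))); auto using dom0, dom_ge0.
Qed.

(** The partial sums differ from the transported full sum by a transported tail, which is O(q^n). *)
Lemma volterra_series e r g : Rabs e = 1 -> dom r -> blip g ->
  is_series (fun n => volterra e (Psi n) r g) (volterra e (tail 0) r g).
Proof.
intros He Hr Hg; pose proof Hg as [B [L [HB _]]].
assert (HB0 : 0 <= B) by (generalize (HB 0), (Rabs_pos (g 0)); lra).
assert (Hsum : forall n, sum_n (fun n => volterra e (Psi n) r g) n
  = volterra e (tail 0) r g - volterra e (tail (S n)) r g :> R).
{ induction n as [|n IH].
  - rewrite sum_O, (volterra_tail_step e 0) by auto; lra.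
  - rewrite sum_Sn, IH, (volterra_tail_step e (S n)) by auto.
    change plus with Rplus; lra. }
change (is_lim_seq (sum_n (fun n => volterra e (Psi n) r g)) (volterra e (tail 0) r g)).
apply (is_lim_seq_ext (fun n => volterra e (tail 0) r g - volterra e (tail (S n)) r g));
  [auto|].
rewrite <- (Rminus_0_r (volterra e (tail 0) r g)) at 1.
apply is_lim_seq_minus'; [apply is_lim_seq_const|].
apply (is_lim_seq_incr_1 (fun n => volterra e (tail n) r g)), is_lim_seq_abs_0.
apply (is_lim_seq_le_le (fun _ => 0) _
  (fun n => C / (1 - q) * B * weight r * q ^ n)).
- intros n; split; [apply Rabs_pos|].
  apply Rle_trans with (1 := volterra_bound e _ _ He (admissible_tail n) r g B Hr Hg HB).
  right; field; lra.
- apply is_lim_seq_const.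
- replace (Finite 0) with (Rbar_mult (C / (1 - q) * B * weight r) 0)
    by (simpl; f_equal; ring).
  apply is_lim_seq_scal_l, is_lim_seq_geom; rewrite Rabs_pos_eq; lra.
Qed.

End Sum.

(** * Exchange between the two families and the coupled fixed point *)

Lemma admissible_source f C : continuous_dom f ->
  (forall t, dom t -> Rabs (f t) <= C * dweight t) ->
  admissible (fun t g => f t * g 0) C.
Proof.
intros Hf HC; split.
- intros; ring.
- intros t g B Ht _ HB; rewrite Rabs_mult.
  replace (C * B * dweight t) with (C * dweight t * B) by ring.
  apply Rmult_le_compat; auto using Rabs_pos.
- intros g _ t Ht eps Heps.
  destruct (continuous_dom_lin (g 0) 0 f f Hf Hf t Ht eps Heps) as [d [Hd H]].
  exists d; split; auto; intros t' Ht' Htt'.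
  replace (_ - _) with (g 0 * f t' + 0 * f t' - (g 0 * f t + 0 * f t)) by ring; auto.
- intros t g a Ht _ Ha H; rewrite H; [ring|].
  generalize (cone_incr 0 t dom0 Ht (dom_ge0 t Ht)); rewrite cone0, Rabs_R0; lra.
Qed.

Lemma dweight0 : dweight 0 = 0.
Proof. unfold dweight, Rdiv; rewrite !pow_i by lia; ring. Qed.

(** Transport turns the two [dweight] bounds into [weight], and [coupling_weight] turns [coupling]
    times their sum back into 2/3 of [dweight]. *)
Lemma admissible_coupling e Phi Psi C : Rabs e = 1 -> 0 <= C ->
  admissible Phi C -> admissible Psi C ->
  admissible (fun t g => coupling t * (volterra (- e) Phi t g - volterra e Psi t g))
    (C * (2 / 3)).
Proof.
intros He HC HPhi HPsi.
assert (He' : Rabs (- e) = 1) by now rewrite Rabs_Ropp.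
assert (Hb : forall t g B, dom t -> blip g -> (forall x, Rabs (g x) <= B) ->
  Rabs (coupling t * (volterra (- e) Phi t g - volterra e Psi t g))
  <= C * (2 / 3) * B * dweight t).
{ intros t g B Ht Hg HB; rewrite Rabs_mult.
  assert (HB0 : 0 <= B) by (generalize (HB 0), (Rabs_pos (g 0)); lra).
  generalize (volterra_bound _ _ _ He' HPhi t g B Ht Hg HB),
    (volterra_bound _ _ _ He HPsi t g B Ht Hg HB); intros H1 H2.
  (* At the vacuum both transported terms vanish, so the value of [coupling 0] is irrelevant. *)
  destruct (Req_dec t 0) as [->|Ht0].
  - rewrite dweight0, Rmult_0_r.
    rewrite weight0, Rmult_0_r in H1, H2.
    replace (volterra (- e) Phi 0 g - volterra e Psi 0 g) with 0.
    + rewrite Rabs_R0; lra.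
    + generalize (Rle_abs (volterra (- e) Phi 0 g)), (Rle_abs (volterra e Psi 0 g)),
        (Rle_abs (- volterra (- e) Phi 0 g)), (Rle_abs (- volterra e Psi 0 g)).
      rewrite !Rabs_Ropp; lra.
  - assert (Hc : 0 <= coupling t)
      by (apply coupling_ge0; auto; generalize (dom_ge0 t Ht); lra).
    rewrite (Rabs_pos_eq (coupling t)) by auto.
    apply Rle_trans with (coupling t * (C * B * weight t + C * B * weight t)).
    + apply Rmult_le_compat_l; auto.
      apply Rle_trans with (1 := Rabs_triang _ _); rewrite Rabs_Ropp; lra.
    + replace (_ * (_ + _)) with (C * B * (coupling t * (2 * weight t))) by ring.
      replace (C * _ * _ * _) with (C * B * (2 / 3 * dweight t)) by ring.
      apply Rmult_le_compat_l; [now apply Rmult_le_pos | now apply coupling_weight]. }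
split; auto.
- intros t a b g h Ht Hg Hh.
  rewrite (volterra_lin _ _ _ He' HPhi), (volterra_lin _ _ _ He HPsi) by auto; ring.
- intros g Hg t Ht eps Heps.
  (* At the vacuum the product is not a product of continuous functions; continuity comes from the
     bound just proved, since [dweight] is continuous and vanishes there. *)
  destruct (Req_dec t 0) as [->|Ht0].
  + pose proof Hg as [B [L [HB _]]].
    destruct (continuous_dom_continuous _ continuous_dweight 0 Ht
      (eps / (C * (2 / 3) * Rabs B + 1))) as [d [Hd H]].
    { assert (0 <= C * (2 / 3) * Rabs B) by (repeat apply Rmult_le_pos; try lra; apply Rabs_pos).
      apply Rdiv_lt_0_compat; lra. }
    exists d; split; auto; intros t' Ht' Htt'.
    specialize (H t' Ht' Htt'); rewrite dweight0, Rminus_0_r in H.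
    rewrite Rabs_pos_eq in H by now apply dweight_ge0.
    assert (HB0 : 0 <= B) by (generalize (HB 0), (Rabs_pos (g 0)); lra).
    rewrite (Rabs_pos_eq B) in H by auto.
    assert (HCB : 0 <= C * (2 / 3) * B) by (repeat apply Rmult_le_pos; lra).
    set (c := eps / _) in *.
    assert (Ee : eps = (C * (2 / 3) * B + 1) * c) by (unfold c; field; lra).
    generalize (Hb t' g B Ht' Hg HB), (Hb 0 g B Ht Hg HB), (dweight_ge0 t' Ht').
    rewrite dweight0, Rmult_0_r; intros H1 H2 H3.
    apply Rle_lt_trans with (1 := Rabs_triang _ _); rewrite Rabs_Ropp; nra.
  + assert (Htp : 0 < t) by (generalize (dom_ge0 t Ht); lra).
    set (F := fun t => volterra (- e) Phi t g - volterra e Psi t g).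
    assert (HF : continuous F t).
    { apply (continuous_minus (V := R_NormedModule));
      apply continuous_continuous_dom; auto;
      eapply continuous_dom_volterra; eauto. }
    assert (HcF := continuous_mult coupling F t (continuous_coupling t Htp Ht) HF).
    destruct (proj1 (filterlim_locally _ _) HcF (mkposreal _ Heps)) as [d Hd].
    exists d; split; [apply cond_pos|]; intros t' _ Htt'; exact (Hd t' Htt').
- intros t g a Ht Hg Ha H.
  rewrite (volterra_supp _ _ _ He' HPhi t g a), (volterra_supp _ _ _ He HPsi t g a) by auto.
  ring.
Qed.

(* Right-hand side produced by n exchanges between the two families. *)
Fixpoint scatter (f : R -> R) (n : nat) (e t : R) (g : R -> R) : R :=
  match n with
  | O => f t * g 0
  | S m => coupling t *
      (volterra (- e) (scatter f m (- e)) t g - volterra e (scatter f m e) t g)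
  end.

Definition source (f : R -> R) (C : R) : Prop :=
  0 <= C /\ continuous_dom f /\ forall t, dom t -> Rabs (f t) <= C * dweight t.

Lemma admissible_scatter f C n e : source f C -> Rabs e = 1 ->
  admissible (scatter f n e) (C * (2 / 3) ^ n).
Proof.
intros [HC [Hf Hb]]; revert e; induction n as [|n IH]; intros e He.
- simpl; rewrite Rmult_1_r; now apply admissible_source.
- replace (C * (2 / 3) ^ S n) with (C * (2 / 3) ^ n * (2 / 3)) by (simpl; ring).
  apply (admissible_coupling e (scatter f n (- e)) (scatter f n e)); auto.
  + apply Rmult_le_pos; auto; apply pow_le; lra.
  + apply IH; now rewrite Rabs_Ropp.
Qed.

(** Complete right-hand side along the family [e], summed over all numbers of exchanges; its
    transport [charac] is the Riemann invariant. *)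
Definition density (f : R -> R) (e : R) : R -> (R -> R) -> R :=
  tail (fun n => scatter f n e) 0.

Definition charac (f : R -> R) (e : R) : R -> (R -> R) -> R :=
  volterra e (density f e).

Lemma two_thirds : 0 <= 2 / 3 < 1.
Proof. lra. Qed.

(** The factor 3 is the geometric sum 1 / (1 - 2/3). *)
Lemma admissible_density f C e : source f C -> Rabs e = 1 ->
  admissible (density f e) (3 * C).
Proof.
intros Hf He; replace (3 * C) with (C * (2 / 3) ^ 0 / (1 - 2 / 3)) by (simpl; field).
apply admissible_tail; auto using two_thirds; [apply Hf|].
intros n; now apply admissible_scatter.
Qed.

(** Removing the term without exchange shifts the index: each remaining term is [coupling] applied
    to transported terms with one exchange fewer, and [volterra_series] sums these. *)
Lemma density_eq f C e t g : source f C -> Rabs e = 1 -> dom t -> blip g ->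
  density f e t g
  = f t * g 0 + coupling t * (charac f (- e) t g - charac f e t g).
Proof.
intros Hf He Ht Hg.
assert (He' : Rabs (- e) = 1) by now rewrite Rabs_Ropp.
assert (HA : forall e, Rabs e = 1 -> forall n, admissible (scatter f n e) (C * (2 / 3) ^ n))
  by (intros; now apply admissible_scatter).
assert (HC : 0 <= C) by apply Hf.
unfold density; rewrite (tail_step _ C (2 / 3)) by auto using two_thirds.
apply Rplus_eq_compat_l.
assert (H1 := volterra_series _ _ _ HC two_thirds (HA e He) e t g He Ht Hg).
assert (H2 := volterra_series _ _ _ HC two_thirds (HA _ He') _ t g He' Ht Hg).
unfold charac, density; rewrite <- (is_series_unique _ _ H1), <- (is_series_unique _ _ H2).
rewrite <- Series_minus by (eexists; eauto).
rewrite <- Series_scal_l; reflexivity.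
Qed.

(** * Riemann invariants and unknowns of the forced problem *)

Section Charac.

Variables (f : R -> R) (C : R).
Hypothesis Hf : source f C.

Lemma charac_lin e r a b g h : Rabs e = 1 -> dom r -> blip g -> blip h ->
  charac f e r (fun x => a * g x + b * h x) = a * charac f e r g + b * charac f e r h.
Proof.
intros He; apply (volterra_lin _ _ _ He (admissible_density f C e Hf He)).
Qed.

Lemma charac_bound e r g B : Rabs e = 1 -> dom r -> blip g ->
  (forall x, Rabs (g x) <= B) -> Rabs (charac f e r g) <= 3 * C * B * weight r.
Proof.
intros He; apply (volterra_bound _ _ _ He (admissible_density f C e Hf He)).
Qed.

Lemma charac_supp e r g a : Rabs e = 1 -> dom r -> blip g -> cone r < a ->
  (forall x, Rabs x < a -> g x = 0) -> charac f e r g = 0.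
Proof.
intros He; apply (volterra_supp _ _ _ He (admissible_density f C e Hf He)).
Qed.

Lemma continuous_dom_charac e g : Rabs e = 1 -> blip g ->
  continuous_dom (fun r => charac f e r g).
Proof.
intros He; apply (continuous_dom_volterra _ _ _ He (admissible_density f C e Hf He)).
destruct Hf; lra.
Qed.

Lemma is_derive_charac e r g g1 M : Rabs e = 1 -> 0 < r -> dom r ->
  blip g -> blip g1 -> taylor2 g g1 M ->
  is_derive (fun r => charac f e r g) r
    (e * speed r * charac f e r g1
     + (f r * g 0 + coupling r * (charac f (- e) r g - charac f e r g))).
Proof.
intros He Hr Hd Hg Hg1 HM.
rewrite <- (density_eq f C) by auto.
apply (is_derive_volterra e _ (3 * C) r g g1 M); auto using admissible_density.
destruct Hf; lra.
Qed.

(* H_nu and k' H_s for the forced problem. *)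
Definition forced_vel (r : R) (g : R -> R) : R :=
  (charac f 1 r g + charac f (Ropp 1) r g) / 2.

Definition forced_grad (r : R) (g : R -> R) : R :=
  (charac f 1 r g - charac f (Ropp 1) r g) / 2.

Lemma Rabs_m1 : Rabs (Ropp 1) = 1.
Proof. rewrite Rabs_Ropp; apply Rabs_R1. Qed.

Hint Resolve Rabs_R1 Rabs_m1 : core.

Lemma is_derive_forced_vel r g g1 M : 0 < r -> dom r ->
  blip g -> blip g1 -> taylor2 g g1 M ->
  is_derive (fun r => forced_vel r g) r (speed r * forced_grad r g1 + f r * g 0).
Proof.
intros Hr Hd Hg Hg1 HM; unfold forced_vel, forced_grad.
assert (H1 := is_derive_charac 1 r g g1 M Rabs_R1 Hr Hd Hg Hg1 HM).
assert (H2 := is_derive_charac (Ropp 1) r g g1 M Rabs_m1 Hr Hd Hg Hg1 HM).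
rewrite Ropp_involutive in H2.
assert (H := is_derive_scal _ _ (/ 2) _ (is_derive_plus _ _ _ _ _ H1 H2)).
eapply is_derive_ext; [|apply (is_derive_eq _ _ _ _ H)]; simpl.
- intros t; unfold plus; simpl; unfold Rdiv; ring.
- unfold plus; simpl; field.
Qed.

(** The exchange terms cancel in the sum of the two invariants and double in their difference, hence
    the damping [2 * coupling] here and none in [is_derive_forced_vel]. *)
Lemma is_derive_forced_grad r g g1 M : 0 < r -> dom r ->
  blip g -> blip g1 -> taylor2 g g1 M ->
  is_derive (fun r => forced_grad r g) r
    (speed r * forced_vel r g1 - 2 * coupling r * forced_grad r g).
Proof.
intros Hr Hd Hg Hg1 HM; unfold forced_vel, forced_grad.
assert (H1 := is_derive_charac 1 r g g1 M Rabs_R1 Hr Hd Hg Hg1 HM).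
assert (H2 := is_derive_charac (Ropp 1) r g g1 M Rabs_m1 Hr Hd Hg Hg1 HM).
rewrite Ropp_involutive in H2.
assert (H := is_derive_scal _ _ (/ 2) _ (is_derive_minus _ _ _ _ _ H1 H2)).
eapply is_derive_ext; [|apply (is_derive_eq _ _ _ _ H)]; simpl.
- intros t; unfold minus, plus, opp; simpl; unfold Rdiv; ring.
- unfold minus, plus, opp; simpl; field.
Qed.

Lemma forced_vel_bound r g B : dom r -> blip g -> (forall x, Rabs (g x) <= B) ->
  Rabs (forced_vel r g) <= 3 * C * B * weight r.
Proof.
intros Hr Hg HB; unfold forced_vel.
generalize (charac_bound 1 r g B Rabs_R1 Hr Hg HB),
  (charac_bound (Ropp 1) r g B Rabs_m1 Hr Hg HB); intros H1 H2.
apply Rabs_le; apply Rabs_le_between in H1; apply Rabs_le_between in H2; lra.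
Qed.

Lemma forced_grad_bound r g B : dom r -> blip g -> (forall x, Rabs (g x) <= B) ->
  Rabs (forced_grad r g) <= 3 * C * B * weight r.
Proof.
intros Hr Hg HB; unfold forced_grad.
generalize (charac_bound 1 r g B Rabs_R1 Hr Hg HB),
  (charac_bound (Ropp 1) r g B Rabs_m1 Hr Hg HB); intros H1 H2.
apply Rabs_le; apply Rabs_le_between in H1; apply Rabs_le_between in H2; lra.
Qed.

Lemma forced_vel_lin r a b g h : dom r -> blip g -> blip h ->
  forced_vel r (fun x => a * g x + b * h x) = a * forced_vel r g + b * forced_vel r h.
Proof.
intros Hr Hg Hh; unfold forced_vel; rewrite !charac_lin by auto; field.
Qed.

Lemma forced_vel_supp r g a : dom r -> blip g -> cone r < a ->
  (forall x, Rabs x < a -> g x = 0) -> forced_vel r g = 0.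
Proof.
intros Hr Hg Ha H; unfold forced_vel; rewrite !(charac_supp _ r g a) by auto; field.
Qed.

Definition dnu (t : R) : R := t ^ 2 / (1 - t ^ 2).

(** H recovered from H_nu with zero data, by integration in nu written in the density variable. *)
Definition forced (r : R) (g : R -> R) : R :=
  RInt (fun t => dnu t * forced_vel t g) 0 r.

Lemma dnu_bounds t : dom t -> 0 <= dnu t <= 1.
Proof.
intros [H1 H2]; unfold dnu.
assert (Hi : 0 < / (1 - t ^ 2)) by (apply Rinv_0_lt_compat; nra).
split.
- apply Rmult_le_pos; [nra | lra].
- apply Rmult_le_reg_r with (1 - t ^ 2); [nra|].
  unfold Rdiv; rewrite Rmult_assoc, Rinv_l by nra; lra.
Qed.

Lemma continuous_dnu t : dom t -> continuous dnu t.
Proof.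
intros [H1 H2]; apply differentiable_continuous; unfold dnu; auto_derive; nra.
Qed.

Lemma continuous_dom_mult F G : continuous_dom F -> continuous_dom G ->
  continuous_dom (fun t => F t * G t).
Proof.
intros HF HG t Ht eps Heps.
set (M := Rabs (F t) + Rabs (G t) + 1).
assert (HM : 1 <= M) by (unfold M; generalize (Rabs_pos (F t)), (Rabs_pos (G t)); lra).
set (c := Rmin 1 (eps / (2 * M))).
assert (Hc : 0 < c) by (apply Rmin_pos; [lra | apply Rdiv_lt_0_compat; lra]).
destruct (HF t Ht c Hc) as [d1 [Hd1 H1]], (HG t Ht c Hc) as [d2 [Hd2 H2]].
exists (Rmin d1 d2); split; [now apply Rmin_pos|]; intros t' Ht' Htt'.
specialize (H1 t' Ht' (Rlt_le_trans _ _ _ Htt' (Rmin_l _ _))).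
specialize (H2 t' Ht' (Rlt_le_trans _ _ _ Htt' (Rmin_r _ _))).
replace (_ - _) with ((F t' - F t) * (G t' - G t) + F t * (G t' - G t)
  + (F t' - F t) * G t) by ring.
assert (Hc1 : c <= 1) by apply Rmin_l.
assert (Hc2 : M * c <= eps / 2).
{ replace (eps / 2) with (M * (eps / (2 * M))) by (field; lra).
  apply Rmult_le_compat_l; [lra | apply Rmin_r]. }
apply Rle_lt_trans with (1 := Rabs_triang _ _).
apply Rle_lt_trans with (1 := Rplus_le_compat_r _ _ _ (Rabs_triang _ _)).
rewrite !Rabs_mult.
generalize (Rabs_pos (F t' - F t)), (Rabs_pos (G t' - G t)),
  (Rabs_pos (F t)), (Rabs_pos (G t)); intros.
apply Rle_lt_trans with (M * c); [unfold M|lra].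
apply Rle_trans with (c * 1 + Rabs (F t) * c + c * Rabs (G t)); [|lra].
repeat apply Rplus_le_compat; apply Rmult_le_compat; lra.
Qed.

Lemma continuous_dom_forced_integrand g : blip g ->
  continuous_dom (fun t => dnu t * forced_vel t g).
Proof.
intros Hg; apply continuous_dom_mult.
- exact (continuous_dom_continuous _ continuous_dnu).
- intros t Ht eps Heps.
  destruct (continuous_dom_lin (/ 2) (/ 2) _ _
    (continuous_dom_charac 1 g Rabs_R1 Hg)
    (continuous_dom_charac (Ropp 1) g Rabs_m1 Hg) t Ht eps Heps) as [d [Hd H]].
  exists d; split; auto; intros t' Ht' Htt'; specialize (H t' Ht' Htt').
  unfold forced_vel; match type of H with Rabs ?a < _ =>
    match goal with |- Rabs ?b < _ => replace b with a by field; auto end end.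
Qed.

Lemma is_derive_forced r g : 0 < r -> dom r -> blip g ->
  is_derive (fun r => forced r g) r (dnu r * forced_vel r g).
Proof.
intros Hr Hd Hg.
apply (is_derive_RInt_dom (fun t => dnu t * forced_vel t g)); auto.
now apply continuous_dom_forced_integrand.
Qed.

Lemma weight_incr y x : dom y -> dom x -> y <= x -> weight y <= weight x.
Proof.
intros Hy Hx Hyx.
assert (H := RInt_dweight y x Hy Hx Hyx).
enough (0 <= weight x - weight y) by lra.
rewrite <- (is_RInt_unique _ _ _ _ H); apply RInt_ge_0; auto.
- eexists; exact H.
- intros t Ht; apply dweight_ge0, (dom_le _ x Hx); generalize (dom_ge0 y Hy); lra.
Qed.

Lemma forced_bound r g B : dom r -> blip g -> (forall x, Rabs (g x) <= B) ->
  Rabs (forced r g) <= 3 * C * B * weight r.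
Proof.
intros Hr Hg HB; pose proof (dom_ge0 r Hr) as Hr0; pose proof (dom_lt_1 r Hr) as Hr1.
assert (HB0 : 0 <= B) by (generalize (HB 0), (Rabs_pos (g 0)); lra).
assert (HK : 0 <= 3 * C * B) by (destruct Hf; apply Rmult_le_pos; lra).
assert (HKw : 0 <= 3 * C * B * weight r) by (apply Rmult_le_pos; auto using weight_ge0).
apply Rle_trans with ((r - 0) * (3 * C * B * weight r)).
- apply abs_RInt_le_const; auto.
  + apply ex_RInt_dom; auto using dom0, continuous_dom_forced_integrand.
  + intros t Ht; assert (Hdt : dom t) by (apply (dom_le _ r Hr); lra).
    rewrite Rabs_mult, (Rabs_pos_eq (dnu t)) by now apply dnu_bounds.
    rewrite <- (Rmult_1_l (3 * C * B * weight r)).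
    apply Rmult_le_compat; try apply Rabs_pos; try now apply dnu_bounds.
    apply Rle_trans with (1 := forced_vel_bound t g B Hdt Hg HB).
    apply Rmult_le_compat_l; auto; apply weight_incr; auto; lra.
- nra.
Qed.

Lemma forced_lin r a b g h : dom r -> blip g -> blip h ->
  forced r (fun x => a * g x + b * h x) = a * forced r g + b * forced r h.
Proof.
intros Hr Hg Hh; unfold forced; apply is_RInt_unique.
apply (is_RInt_ext (fun t =>
  plus (scal a (dnu t * forced_vel t g)) (scal b (dnu t * forced_vel t h)))).
- rewrite Rmin_left, Rmax_right by apply Hr; intros t Ht.
  rewrite forced_vel_lin by (auto; apply (dom_le _ r Hr); lra).
  change (a * (dnu t * forced_vel t g) + b * (dnu t * forced_vel t h)
    = dnu t * (a * forced_vel t g + b * forced_vel t h)); ring.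
- apply (is_RInt_plus (V := R_NormedModule));
  apply (is_RInt_scal (V := R_NormedModule)), (RInt_correct (V := R_CompleteNormedModule));
  apply ex_RInt_dom; auto using dom0, dom_ge0, continuous_dom_forced_integrand.
Qed.

Lemma forced_supp r g a : dom r -> blip g -> cone r < a ->
  (forall x, Rabs x < a -> g x = 0) -> forced r g = 0.
Proof.
intros Hr Hg Ha H; unfold forced.
rewrite (RInt_ext _ (fun _ => 0)).
- rewrite RInt_const; apply Rmult_0_r.
- rewrite Rmin_left, Rmax_right by apply Hr; intros t Ht.
  assert (Hd : dom t) by (apply (dom_le _ r Hr); lra).
  generalize (cone_incr t r Hd Hr); intros Hc.
  rewrite (forced_vel_supp t g a); auto; [apply Rmult_0_r | lra].
Qed.

End Charac.

(** * Return from the first-order system to the second-order equation *)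

Lemma constant_zero F r : 0 < r -> (forall t, 0 < t <= r -> is_derive F t 0) ->
  filterlim F (at_right 0) (locally 0) -> F r = 0.
Proof.
intros Hr HF Hlim.
assert (Hle : forall eps, 0 < eps -> Rabs (F r) <= eps).
{ intros eps Heps.
  destruct (proj1 (filterlim_locally _ _) Hlim (mkposreal _ Heps)) as [d H].
  pose proof (Rmin_l (d / 2) (r / 2)); pose proof (Rmin_r (d / 2) (r / 2)).
  set (y := Rmin (d / 2) (r / 2)) in *.
  assert (Hy : 0 < y) by (apply Rmin_pos; [generalize (cond_pos d) |]; lra).
  assert (HFy : Rabs (F y - 0) < eps).
  { apply (H y); auto; change (Rabs (y - 0) < d).
    rewrite Rabs_pos_eq by lra; generalize (cond_pos d); lra. }
  rewrite Rminus_0_r in HFy.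
  rewrite <- (eq_is_derive F y r); [lra | | lra].
  intros t Ht; apply HF; lra. }
destruct (Req_dec (F r) 0) as [E|E]; auto.
specialize (Hle (Rabs (F r) / 2)); generalize (Rabs_pos_lt _ E); lra.
Qed.

(** All limits at the vacuum below come with a linear rate on (0, 1/2], an interval that stays away
    from the sonic density 1 / sqrt 2. *)
Lemma filterlim_linear_bound F l K : 
  (forall r, 0 < r <= 1 / 2 -> Rabs (F r - l) <= K * r) ->
  filterlim F (at_right 0) (locally l).
Proof.
intros H; apply filterlim_locally; intros eps.
assert (HK : 0 <= K).
{ generalize (H (1 / 2)), (Rabs_pos (F (1 / 2) - l)); lra. }
assert (Hp : 0 < Rmin (1 / 2) (eps / (K + 1))).
{ apply Rmin_pos; [lra|]; apply Rdiv_lt_0_compat; [apply cond_pos | lra]. }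
exists (mkposreal _ Hp); intros r Hr Hr0.
change (Rabs (r - 0) < Rmin (1 / 2) (eps / (K + 1))) in Hr.
rewrite Rminus_0_r, Rabs_pos_eq in Hr by lra.
assert (H1 := Rlt_le_trans _ _ _ Hr (Rmin_l _ _)).
assert (H2 := Rlt_le_trans _ _ _ Hr (Rmin_r _ _)).
apply Rle_lt_trans with (K * r); [apply H; lra|].
assert (E : pos eps = (K + 1) * (eps / (K + 1))) by (field; lra).
rewrite E; set (c := eps / (K + 1)) in *; nra.
Qed.

Lemma weight_small r : 0 < r <= 1 / 2 -> dom r /\ 0 <= weight r <= r.
Proof.
intros Hr; assert (Hd : dom r) by (split; nra); split; auto; split.
- now apply weight_ge0.
- unfold weight; apply Rmult_le_reg_r with (1 - 2 * r ^ 2); [nra|].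
  unfold Rdiv; rewrite Rmult_assoc, Rinv_l by nra; nra.
Qed.

Section Smooth.

Variables (f : R -> R) (C : R).
Hypothesis Hf : source f C.

(** Compatibility of the two unknowns, with the s-derivative on the test function. The prefactor
    1/k' has logarithmic derivative [2 * coupling], which cancels the damping of [forced_grad], and
    its product with [speed] is [dnu]; both sides then have derivative [dnu * forced_vel] at [g1],
    and both tend to 0 at the vacuum. *)
Lemma forced_grad_eq r g g1 M : 0 < r -> dom r ->
  blip g -> blip g1 -> taylor2 g g1 M ->
  r ^ 2 / sqrt (1 - 2 * r ^ 2) * forced_grad f r g = forced f r g1.
Proof.
intros Hr Hd Hg Hg1 HM.
apply Rminus_diag_uniq.
apply (constant_zero (fun r => r ^ 2 / sqrt (1 - 2 * r ^ 2) * forced_grad f r g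
  - forced f r g1)); auto.
- intros t Ht; assert (Hdt : dom t) by (apply (dom_le _ r Hd); lra).
  assert (Ht0 : 0 < t) by lra.
  pose proof Hdt as [_ Ht2].
  assert (H1 := is_derive_forced_grad f C Hf t g g1 M Ht0 Hdt Hg Hg1 HM).
  assert (H2 := is_derive_forced f C Hf t g1 Ht0 Hdt Hg1).
  set (s := sqrt (1 - 2 * t ^ 2)).
  assert (Hs : 0 < s) by (apply sqrt_lt_R0; lra).
  assert (Hs2 : s * s = 1 - 2 * t ^ 2) by (apply sqrt_sqrt; lra).
  assert (Hm : is_derive (fun t => t ^ 2 / sqrt (1 - 2 * t ^ 2)) t
    (2 * t / s + 2 * t ^ 3 / s ^ 3)).
  { auto_derive.
    - replace (1 + - (2 * (t * (t * 1)))) with (s * s) by (rewrite Hs2; ring).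
      rewrite sqrt_square by lra; repeat split; nra.
    - replace (1 + - (2 * (t * (t * 1)))) with (s * s) by (rewrite Hs2; ring).
      rewrite sqrt_square by lra; field; lra. }
  assert (H := is_derive_minus _ _ _ _ _
    (is_derive_mult _ _ _ _ _ Hm H1 Rmult_comm) H2).
  apply (is_derive_eq _ _ _ _ H).
  unfold minus, plus, opp, mult; simpl; unfold mult; simpl.
  unfold speed, coupling, dnu; fold s; fold (t ^ 2).
  change (t * (t * 1)) with (t ^ 2); fold s.
  rewrite <- Hs2.
  assert (1 - t ^ 2 <> 0) by nra.
  field; repeat split; try lra; auto.
- destruct Hf as [HC _].
  destruct Hg as [B [L [HB HL]]], Hg1 as [B1 [L1 [HB1 HL1]]].
  assert (HB0 : 0 <= B) by (generalize (HB 0), (Rabs_pos (g 0)); lra).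
  apply (filterlim_linear_bound _ _ (3 * C * B + 3 * C * B1)); intros t Ht.
  destruct (weight_small t Ht) as [Hdt Hw].
  assert (Hs : 1 / 2 <= sqrt (1 - 2 * t ^ 2)).
  { rewrite <- (sqrt_square (1 / 2)) by lra; apply sqrt_le_1_alt; nra. }
  assert (Hm : 0 <= t ^ 2 / sqrt (1 - 2 * t ^ 2) <= 1).
  { split.
    - apply Rmult_le_pos; [nra|]; apply Rlt_le, Rinv_0_lt_compat; lra.
    - apply Rmult_le_reg_r with (sqrt (1 - 2 * t ^ 2)); [lra|].
      unfold Rdiv; rewrite Rmult_assoc, Rinv_l by lra; nra. }
  rewrite Rminus_0_r.
  apply Rle_trans with (1 := Rabs_triang _ _).
  rewrite Rabs_Ropp, Rabs_mult, (Rabs_pos_eq (_ / _)), Rmult_plus_distr_r by apply Hm.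
  assert (H1 : Rabs (forced_grad f t g) <= 3 * C * B * weight t)
    by (eapply forced_grad_bound; eauto; now exists B, L).
  assert (H2 : Rabs (forced f t g1) <= 3 * C * B1 * weight t)
    by (eapply forced_bound; eauto; now exists B1, L1).
  assert (HB1' : 0 <= B1) by (generalize (HB1 0), (Rabs_pos (g1 0)); lra).
  assert (0 <= 3 * C * B) by (apply Rmult_le_pos; lra).
  assert (0 <= 3 * C * B1) by (apply Rmult_le_pos; lra).
  generalize (Rabs_pos (forced_grad f t g)); intros; apply Rplus_le_compat; nra.
Qed.

(** Compatibility at [g1] eliminates [forced_grad]: [speed] times k' is the coefficient of H_ss, and
    the source enters as f delta_0. *)
Lemma is_derive_forced_vel2 r g g1 g2 M M1 : 0 < r -> dom r ->
  blip g -> blip g1 -> blip g2 -> taylor2 g g1 M -> taylor2 g1 g2 M1 ->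
  is_derive (fun r => forced_vel f r g) r
    ((1 - 2 * r ^ 2) / (r ^ 2 * (1 - r ^ 2)) * forced f r g2 + f r * g 0).
Proof.
intros Hr Hd Hg Hg1 Hg2 HM HM1.
assert (H := is_derive_forced_vel f C Hf r g g1 M Hr Hd Hg Hg1 HM).
rewrite <- (forced_grad_eq r g1 g2 M1) by auto.
apply (is_derive_eq _ _ _ _ H).
unfold speed; pose proof Hd as [_ Hr2].
set (s := sqrt (1 - 2 * r ^ 2)).
assert (Hs : 0 < s) by (apply sqrt_lt_R0; lra).
assert (Hs2 : s * s = 1 - 2 * r ^ 2) by (apply sqrt_sqrt; lra).
rewrite <- Hs2; field; repeat split; nra.
Qed.

End Smooth.

(** * Uniform bounds on test functions and their derivatives *)

Lemma test_is_derive phi j x : is_test_fun phi ->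
  is_derive (Derive_n phi j) x (Derive_n phi (S j) x).
Proof. intros [H _]; apply Derive_correct; exact (H (S j) x). Qed.

Lemma test_zero phi M j x : (forall x, M < Rabs x -> phi x = 0) ->
  M < Rabs x -> Derive_n phi j x = 0.
Proof.
intros H Hx.
rewrite (Derive_n_ext_loc phi (fun _ => 0)).
- destruct j; [reflexivity | apply Derive_n_const].
- assert (Hd : 0 < Rabs x - M) by lra.
  exists (mkposreal _ Hd); intros y Hy; apply H.
  change (Rabs (y - x) < Rabs x - M) in Hy.
  generalize (Rabs_triang_inv x y); rewrite (Rabs_minus_sym x y); lra.
Qed.

Lemma test_bounded phi j : is_test_fun phi ->
  exists B, forall x, Rabs (Derive_n phi j x) <= B.
Proof.
intros Hphi; pose proof Hphi as [_ [M HM]].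
destruct (continuity_ab_maj (fun x => Rabs (Derive_n phi j x)) (- Rabs M) (Rabs M))
  as [y [Hy _]].
- generalize (Rabs_pos M); lra.
- intros c _; apply continuity_pt_comp with (f2 := Rabs); [|apply Rcontinuity_abs].
  apply continuity_pt_filterlim, differentiable_continuous.
  eexists; now apply test_is_derive.
- exists (Rabs (Derive_n phi j y)); intros x.
  destruct (Rle_dec (Rabs x) (Rabs M)) as [H|H].
  + apply Hy; now apply Rabs_le_between.
  + rewrite (test_zero phi M j x), Rabs_R0; auto using Rabs_pos.
    generalize (Rle_abs M); lra.
Qed.

Lemma mvt_bound (g g1 : R -> R) B x y : (forall x, is_derive g x (g1 x)) ->
  (forall c, Rmin x y <= c <= Rmax x y -> Rabs (g1 c) <= B) ->
  Rabs (g y - g x) <= B * Rabs (y - x).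
Proof.
intros Hd HB.
destruct (MVT_gen g x y g1) as [c [Hc E]]; auto.
- intros z _; apply continuity_pt_filterlim, differentiable_continuous.
  eexists; apply Hd.
- rewrite E, Rabs_mult; apply Rmult_le_compat_r; auto using Rabs_pos.
Qed.

Lemma test_blip phi j : is_test_fun phi -> blip (Derive_n phi j).
Proof.
intros Hphi; destruct (test_bounded phi j Hphi) as [B HB].
destruct (test_bounded phi (S j) Hphi) as [L HL].
exists B, L; split; auto; intros x y.
apply (mvt_bound _ (Derive_n phi (S j))); auto; intros; now apply test_is_derive.
Qed.

Lemma test_taylor2 phi j : is_test_fun phi ->
  exists M, taylor2 (Derive_n phi j) (Derive_n phi (S j)) M.
Proof.
intros Hphi; destruct (test_bounded phi (S (S j)) Hphi) as [M HM].
assert (HM0 : 0 <= M).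
{ generalize (HM 0), (Rabs_pos (Derive_n phi (S (S j)) 0)); lra. }
exists M; intros x s.
set (g := Derive_n phi j); set (g1 := Derive_n phi (S j)) in *.
(* The mean value bound is applied to [g] minus its tangent slope at [x], whose derivative is at
   most [M * Rabs s] between [x] and [x + s]. *)
assert (H := mvt_bound (fun y => g y - y * g1 x) (fun y => g1 y - g1 x)
  (M * Rabs s) x (x + s)).
replace (g (x + s) - g x - s * g1 x)
  with (g (x + s) - (x + s) * g1 x - (g x - x * g1 x)) by ring.
apply Rle_trans with (M * Rabs s * Rabs (x + s - x)).
- apply H.
  + intros y; apply (is_derive_minus g (fun y => y * g1 x)).
    * now apply test_is_derive.
    * auto_derive; [trivial | ring].
  + intros c Hc.
    apply Rle_trans with (M * Rabs (c - x)).
    * apply (mvt_bound g1 (Derive_n phi (S (S j)))); auto.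
      intros; now apply test_is_derive.
    * apply Rmult_le_compat_l; auto.
      destruct (Rle_dec 0 s).
      -- rewrite Rmin_left, Rmax_right in Hc by lra; rewrite !Rabs_pos_eq; lra.
      -- rewrite Rmin_right, Rmax_left in Hc by lra; rewrite !Rabs_left1; lra.
- replace (x + s - x) with s by ring; right.
  rewrite Rmult_assoc, <- Rabs_mult, Rabs_pos_eq; simpl; [ring | nra].
Qed.

(** * The explicit expansion corrected by forced solutions *)

Lemma is_derive_sum_f_R0 (F dF : nat -> R -> R) x n :
  (forall j, (j <= n)%nat -> is_derive (F j) x (dF j x)) ->
  is_derive (fun t => sum_f_R0 (fun j => F j t) n) x (sum_f_R0 (fun j => dF j x) n).
Proof.
induction n as [|n IH]; intros H; simpl.
- now apply H.
- apply (is_derive_plus (fun t => sum_f_R0 (fun j => F j t) n) (F (S n))).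
  + apply IH; auto.
  + apply H; lia.
Qed.

Lemma Rabs_sum_le (a b : nat -> R) n :
  (forall j, (j <= n)%nat -> Rabs (a j) <= b j) ->
  Rabs (sum_f_R0 a n) <= sum_f_R0 b n.
Proof.
intros H; apply Rle_trans with (1 := Rsum_abs _ _); apply sum_Rle; auto.
Qed.

Lemma Derive_n_test_lin phi psi a b n : is_test_fun phi -> is_test_fun psi ->
  Derive_n (fun x => a * phi x + b * psi x) n
  = fun x => a * Derive_n phi n x + b * Derive_n psi n x.
Proof.
intros [H1 _] [H2 _]; apply functional_extensionality; intros x.
rewrite Derive_n_plus, !Derive_n_scal_l; auto;
exists (mkposreal 1 Rlt_0_1); intros y _ k _; now apply ex_derive_n_scal_l.
Qed.

(* k'(nu)^2 times dnu/dr. *)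
Definition kap (r : R) : R := (1 - 2 * r ^ 2) / (r ^ 2 * (1 - r ^ 2)).

(** Two s-derivatives raise delta_0^(2i) to index i + 1, so this is the coefficient of delta_0^(2j)
    in H_ss. *)
Definition prev (al : nat -> R -> R) (j : nat) : R -> R :=
  match j with O => fun _ => 0 | S i => al i end.

(* [be j] is the nu-derivative of [al j], and [f j] the r-density of the residual left by
   the expansion in front of the (2j)-th derivative of delta_0. *)
Record ansatz (al be f : nat -> R -> R) : Prop := {
  ans_al : forall j r, (j <= 3)%nat -> 0 < r -> dom r ->
    is_derive (al j) r (dnu r * be j r);
  ans_be : forall j r, (j <= 3)%nat -> 0 < r -> dom r ->
    is_derive (be j) r (f j r + kap r * prev al j r);
  ans_last : forall r, al 3%nat r = 0;
  ans_source : forall j, (j <= 3)%nat -> source (f j) 10 }.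

(** Subtracting the forced solution of source [f j], tested with the (2j)-th derivative, cancels the
    residual of the expansion exactly. *)
Definition core (al f : nat -> R -> R) (r : R) (phi : R -> R) : R :=
  sum_f_R0 (fun j => al j r * Derive_n phi (2 * j) 0
    - forced (f j) r (Derive_n phi (2 * j))) 3.

Definition core_vel (be f : nat -> R -> R) (r : R) (phi : R -> R) : R :=
  sum_f_R0 (fun j => be j r * Derive_n phi (2 * j) 0
    - forced_vel (f j) r (Derive_n phi (2 * j))) 3.

Section Ansatz.

Variables al be f : nat -> R -> R.
Hypothesis HA : ansatz al be f.

Lemma is_derive_core phi r : is_test_fun phi -> 0 < r -> dom r ->
  is_derive (fun r => core al f r phi) r (dnu r * core_vel be f r phi).
Proof.
intros Hphi Hr Hd; unfold core, core_vel; rewrite scal_sum.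
apply (is_derive_sum_f_R0
  (fun j r => al j r * Derive_n phi (2 * j) 0 - forced (f j) r (Derive_n phi (2 * j)))
  (fun j r => (be j r * Derive_n phi (2 * j) 0
     - forced_vel (f j) r (Derive_n phi (2 * j))) * dnu r)).
intros j Hj.
assert (H1 := ans_al _ _ _ HA j r Hj Hr Hd).
assert (H2 := is_derive_forced (f j) 10 (ans_source _ _ _ HA j Hj) r
  (Derive_n phi (2 * j)) Hr Hd (test_blip _ _ Hphi)).
assert (H := is_derive_minus _ _ _ _ _
  (is_derive_scal_l _ _ _ (Derive_n phi (2 * j) 0) H1) H2).
apply (is_derive_eq _ _ _ _ H).
unfold minus, plus, opp, scal; simpl; unfold mult; simpl; ring.
Qed.

Lemma is_derive_core_vel phi r : is_test_fun phi -> 0 < r -> dom r ->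
  is_derive (fun r => core_vel be f r phi) r (kap r * core al f r (Derive_n phi 2)).
Proof.
intros Hphi Hr Hd.
set (D := fun j => Derive_n phi (2 * j)).
assert (Hterm : forall j, (j <= 3)%nat -> is_derive (fun r => be j r * D j 0
  - forced_vel (f j) r (D j)) r (kap r * (prev al j r * D j 0 - forced (f j) r (D (S j))))).
{ intros j Hj.
  assert (H1 := ans_be _ _ _ HA j r Hj Hr Hd).
  destruct (test_taylor2 phi (2 * j) Hphi) as [M HM].
  destruct (test_taylor2 phi (S (2 * j)) Hphi) as [M1 HM1].
  assert (H2 := is_derive_forced_vel2 (f j) 10 (ans_source _ _ _ HA j Hj) r
    _ _ _ M M1 Hr Hd (test_blip _ _ Hphi) (test_blip _ _ Hphi)
    (test_blip _ _ Hphi) HM HM1).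
  assert (H := is_derive_minus _ _ _ _ _ (is_derive_scal_l _ _ _ (D j 0) H1) H2).
  apply (is_derive_eq _ _ _ _ H).
  replace (S (S (2 * j))) with (2 * S j)%nat by lia; fold (D (S j)) (D j) (kap r).
  unfold minus, plus, opp, scal; simpl; unfold mult; simpl; ring. }
apply (is_derive_eq _ _ (sum_f_R0 (fun j => kap r *
  (prev al j r * D j 0 - forced (f j) r (D (S j)))) 3)).
- exact (is_derive_sum_f_R0 _ (fun j r => kap r *
    (prev al j r * D j 0 - forced (f j) r (D (S j)))) r 3 Hterm).
- assert (HD : forall j, Derive_n (Derive_n phi 2) (2 * j) = D (S j)).
  { intros j; apply functional_extensionality; intros x.
    rewrite Derive_n_comp; unfold D; f_equal; lia. }
  (* The sums match after shifting the index by one; the index 4 term that H_ss would add is absent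
     because [al 3] vanishes. *)
  unfold core; cbn [sum_f_R0 prev]; rewrite !HD, (ans_last _ _ _ HA); ring.
Qed.

Lemma core_lin r phi psi a b : dom r -> is_test_fun phi -> is_test_fun psi ->
  core al f r (fun x => a * phi x + b * psi x)
  = a * core al f r phi + b * core al f r psi.
Proof.
intros Hd H1 H2; unfold core; rewrite !scal_sum, <- plus_sum.
apply sum_eq; intros j Hj.
rewrite Derive_n_test_lin by auto.
rewrite (forced_lin (f j) 10 (ans_source _ _ _ HA j Hj)) by auto using test_blip; ring.
Qed.

Lemma core_bound r phi B : dom r -> is_test_fun phi ->
  (forall j x, (j <= 6)%nat -> Rabs (Derive_n phi j x) <= B j) ->
  Rabs (core al f r phi)
  <= (sum_f_R0 (fun j => Rabs (al j r)) 3 + 30 * weight r) * sum_f_R0 B 6.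
Proof.
intros Hd Hphi HB.
(* 30 is 3 * 10: the factor in [forced_bound] times the common source constant. *)
set (K := sum_f_R0 _ 3 + 30 * weight r).
assert (HB0 : forall j, (j <= 6)%nat -> 0 <= B j).
{ intros j Hj; generalize (HB j 0 Hj), (Rabs_pos (Derive_n phi j 0)); lra. }
assert (Hw := weight_ge0 r Hd).
assert (HK : forall j, (j <= 3)%nat -> Rabs (al j r) + 30 * weight r <= K).
{ generalize (Rabs_pos (al 0%nat r)), (Rabs_pos (al 1%nat r)),
    (Rabs_pos (al 2%nat r)), (Rabs_pos (al 3%nat r)); intros.
  unfold K; simpl; destruct j as [|[|[|[|j]]]]; try lra; lia. }
apply Rle_trans with (sum_f_R0 (fun j => K * B (2 * j)%nat) 3).
- apply Rabs_sum_le; intros j Hj.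
  apply Rle_trans with (1 := Rabs_triang _ _); rewrite Rabs_Ropp, Rabs_mult.
  assert (H1 := HB (2 * j)%nat 0 ltac:(lia)).
  assert (H2 := forced_bound (f j) 10 (ans_source _ _ _ HA j Hj) r _ (B (2 * j)%nat) Hd
    (test_blip _ _ Hphi) (fun x => HB (2 * j)%nat x ltac:(lia))).
  apply Rle_trans with ((Rabs (al j r) + 30 * weight r) * B (2 * j)%nat).
  + rewrite Rmult_plus_distr_r; apply Rplus_le_compat.
    * apply Rmult_le_compat_l; auto using Rabs_pos.
    * apply Rle_trans with (1 := H2); right; ring.
  + apply Rmult_le_compat_r; [apply HB0; lia | auto].
- rewrite <- (Rmult_comm (sum_f_R0 B 6)), (Rmult_comm (sum_f_R0 B 6)).
  assert (H0 : 0 <= K) by (specialize (HK 0%nat ltac:(lia));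
    generalize (Rabs_pos (al 0%nat r)); lra).
  replace (sum_f_R0 _ 3) with (K * (B 0%nat + B 2%nat + B 4%nat + B 6%nat))
    by (simpl; ring).
  apply Rmult_le_compat_l; auto; simpl.
  generalize (HB0 1%nat ltac:(lia)), (HB0 3%nat ltac:(lia)), (HB0 5%nat ltac:(lia)); lra.
Qed.

Lemma core_supp r phi eps : dom r -> is_test_fun phi -> 0 < eps ->
  (forall x, Rabs x < cone r + eps -> phi x = 0) -> core al f r phi = 0.
Proof.
intros Hd Hphi He H.
assert (HD : forall j x, Rabs x < cone r + eps -> Derive_n phi j x = 0).
{ intros j x Hx; rewrite (Derive_n_ext_loc phi (fun _ => 0)).
  - destruct j; [reflexivity | apply Derive_n_const].
  - assert (Hd' : 0 < cone r + eps - Rabs x) by lra.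
    exists (mkposreal _ Hd'); intros y Hy; apply H.
    change (Rabs (y - x) < cone r + eps - Rabs x) in Hy.
    generalize (Rabs_triang_inv y x); lra. }
unfold core; rewrite (sum_eq _ (fun _ => 0)); [simpl; ring|].
intros j Hj.
rewrite (forced_supp (f j) 10 (ans_source _ _ _ HA j Hj) r _ (cone r + eps));
  auto using test_blip; [|lra].
rewrite HD; [ring|].
generalize (cone_incr 0 r dom0 Hd (dom_ge0 r Hd)); rewrite cone0, Rabs_R0; lra.
Qed.

(** The forced corrections are O(r), so initial values can be read off the explicit coefficients. *)
Lemma core_small phi : is_test_fun phi -> exists K, 0 <= K /\ forall r, 0 < r <= 1 / 2 ->
  Rabs (core al f r phi - sum_f_R0 (fun j => al j r * Derive_n phi (2 * j) 0) 3) <= K * r /\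
  Rabs (core_vel be f r phi - sum_f_R0 (fun j => be j r * Derive_n phi (2 * j) 0) 3) <= K * r.
Proof.
intros Hphi.
destruct (test_bounded phi (2 * 0) Hphi) as [B0 HB0].
destruct (test_bounded phi (2 * 1) Hphi) as [B1 HB1].
destruct (test_bounded phi (2 * 2) Hphi) as [B2 HB2].
destruct (test_bounded phi (2 * 3) Hphi) as [B3 HB3].
set (B := Rabs B0 + Rabs B1 + Rabs B2 + Rabs B3).
assert (HB : forall j, (j <= 3)%nat -> forall x, Rabs (Derive_n phi (2 * j) x) <= B).
{ generalize (Rle_abs B0), (Rle_abs B1), (Rle_abs B2), (Rle_abs B3),
    (Rabs_pos B0), (Rabs_pos B1), (Rabs_pos B2), (Rabs_pos B3).
  intros; specialize (HB0 x); specialize (HB1 x); specialize (HB2 x); specialize (HB3 x).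
  destruct j as [|[|[|[|j]]]]; try lia; unfold B; lra. }
assert (HBp : 0 <= B) by (unfold B; repeat apply Rplus_le_le_0_compat; apply Rabs_pos).
exists (4 * (30 * B)); split; [lra|]; intros r Hr.
destruct (weight_small r Hr) as [Hd Hw].
split.
- unfold core; rewrite <- minus_sum.
  apply Rle_trans with (sum_f_R0 (fun _ => 30 * B * r) 3); [|simpl; lra].
  apply Rabs_sum_le; intros j Hj.
  replace (_ - _ - _) with (- forced (f j) r (Derive_n phi (2 * j))) by ring.
  rewrite Rabs_Ropp.
  apply Rle_trans with (1 := forced_bound (f j) 10 (ans_source _ _ _ HA j Hj) r _ B Hd
    (test_blip _ _ Hphi) (HB j Hj)).
  replace (3 * 10 * B) with (30 * B) by ring; apply Rmult_le_compat_l; lra.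
- unfold core_vel; rewrite <- minus_sum.
  apply Rle_trans with (sum_f_R0 (fun _ => 30 * B * r) 3); [|simpl; lra].
  apply Rabs_sum_le; intros j Hj.
  replace (_ - _ - _) with (- forced_vel (f j) r (Derive_n phi (2 * j))) by ring.
  rewrite Rabs_Ropp.
  apply Rle_trans with (1 := forced_vel_bound (f j) 10 (ans_source _ _ _ HA j Hj) r _ B Hd
    (test_blip _ _ Hphi) (HB j Hj)).
  replace (3 * 10 * B) with (30 * B) by ring; apply Rmult_le_compat_l; lra.
Qed.

End Ansatz.

(** * Explicit expansions for the two sets of initial data *)

Lemma source_intro f : (forall t, dom t -> ex_derive f t) ->
  (forall t, dom t -> Rabs (f t) <= 30 * t ^ 2) -> source f 10.
Proof.
intros Hd Hb; repeat split; [lra| |].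
- apply continuous_dom_continuous; intros t Ht.
  apply differentiable_continuous; auto.
- intros t Ht; apply Rle_trans with (1 := Hb t Ht).
  (* [dweight t] is at least 3 t^2, so 30 t^2 is covered by the constant 10. *)
  pose proof Ht as [H1 H2]; unfold dweight.
  assert (Hi : 1 <= / (1 - 2 * t ^ 2)).
  { rewrite <- Rinv_1 at 1; apply Rinv_le_contravar; nra. }
  assert (0 <= 4 * t ^ 4 / (1 - 2 * t ^ 2) ^ 2).
  { apply Rmult_le_pos; [apply Rmult_le_pos; [lra | apply pow_le; lra]|].
    apply Rlt_le, Rinv_0_lt_compat, pow_lt; lra. }
  assert (0 <= t ^ 2) by apply pow2_ge_0.
  unfold Rdiv at 1; nra.
Qed.

(** [kap] freed of its double pole: [kap r] is [kap0 r / r^2]. *)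
Definition kap0 (r : R) : R := (1 - 2 * r ^ 2) / (1 - r ^ 2).

Lemma kap0_bound r : dom r -> 0 <= kap0 r <= 1.
Proof.
intros [H1 H2]; unfold kap0.
assert (0 < / (1 - r ^ 2)) by (apply Rinv_0_lt_compat; nra).
split.
- apply Rmult_le_pos; lra.
- apply Rmult_le_reg_r with (1 - r ^ 2); [nra|].
  unfold Rdiv; rewrite Rmult_assoc, Rinv_l by nra; nra.
Qed.

(** Obtained by integrating leading terms in r alternately for [be_r] and [al_r], from H_nu =
    delta_0. Higher-order corrections, such as 1 - r^4 in place of 1, make each [be_r j] divisible
    by 1 - r^2; this cancels the denominator of [dnu] and keeps [al_r] polynomial. The expansion
    stops once [kap * al_r j] is O(r^2) and can be left in [f_r]. *)
Definition al_r (j : nat) (r : R) : R :=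
  match j with
  | 0%nat => r ^ 3 / 3 + r ^ 5 / 5
  | 1%nat => r ^ 5 / 30
  | _ => 0
  end.

Definition be_r (j : nat) (r : R) : R :=
  match j with
  | 0%nat => 1 - r ^ 4
  | 1%nat => r ^ 2 * (1 - r ^ 2) / 6
  | _ => 0
  end.

Definition f_r (j : nat) (r : R) : R :=
  match j with
  | 0%nat => - 4 * r ^ 3
  | 1%nat => - (8 / 15) * r ^ 3 * kap0 r
  | 2%nat => - (1 / 30) * r ^ 3 * kap0 r
  | _ => 0
  end.

(** Same recipe from H = delta_0. As [kap] is 1/r^2 - 1/(1 - r^2), integrating its first terms gives
    -1/r - r in [be_s 1]; the pole is the datum -delta_0'' of rho H_nu, and a further 2 r^3 restores
    divisibility by 1 - r^2. The data being more singular, residuals reach index 3, which sets the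
    length of all the sums. *)
Definition al_s (j : nat) (r : R) : R :=
  match j with
  | 0%nat => 1
  | 1%nat => - r ^ 2 / 2 - r ^ 4 / 2
  | 2%nat => - r ^ 4 / 8
  | _ => 0
  end.

Definition be_s (j : nat) (r : R) : R :=
  match j with
  | 1%nat => - ((1 - r ^ 2) * (1 + 2 * r ^ 2)) / r
  | 2%nat => - (r * (1 - r ^ 2)) / 2
  | _ => 0
  end.

Definition f_s (j : nat) (r : R) : R :=
  match j with
  | 1%nat => 6 * r ^ 2 + r ^ 2 / (1 - r ^ 2)
  | 2%nat => 3 / 2 * r ^ 2 - r ^ 4 / (1 - r ^ 2)
  | 3%nat => 1 / 8 * r ^ 2 * kap0 r
  | _ => 0
  end.

Lemma ansatz_r : ansatz al_r be_r f_r.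
Proof.
split; auto.
- intros j r Hj Hr [_ Hd]; assert (r < 1) by nra.
  destruct j as [|[|[|[|j]]]]; try lia; unfold al_r, be_r, dnu; auto_derive; trivial;
    field; nra.
- intros j r Hj Hr [_ Hd]; assert (r < 1) by nra.
  destruct j as [|[|[|[|j]]]]; try lia; unfold al_r, be_r, f_r, prev, kap, kap0;
    auto_derive; trivial; field; repeat split; nra.
- intros j Hj; apply source_intro; intros t Ht; pose proof Ht as [H1 H2];
  assert (t < 1) by nra.
  + destruct j as [|[|[|[|j]]]]; try lia; unfold f_r, kap0; auto_derive; trivial; nra.
  + generalize (kap0_bound t Ht); intros Hk.
    assert (0 <= t ^ 3 <= t ^ 2) by (split; [apply pow_le|]; nra).
    assert (0 <= t ^ 3 * kap0 t <= t ^ 3) by (split; nra).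
    destruct j as [|[|[|[|j]]]]; try lia; unfold f_r; apply Rabs_le; nra.
Qed.

Lemma ansatz_s : ansatz al_s be_s f_s.
Proof.
split; auto.
- intros j r Hj Hr [_ Hd]; assert (r < 1) by nra.
  destruct j as [|[|[|[|j]]]]; try lia; unfold al_s, be_s, dnu; auto_derive; trivial;
    field; repeat split; nra.
- intros j r Hj Hr [_ Hd]; assert (r < 1) by nra.
  destruct j as [|[|[|[|j]]]]; try lia; unfold al_s, be_s, f_s, prev, kap, kap0;
    auto_derive; trivial; try lra; field; repeat split; nra.
- intros j Hj; apply source_intro; intros t Ht; pose proof Ht as [H1 H2];
  assert (t < 1) by nra.
  + destruct j as [|[|[|[|j]]]]; try lia; unfold f_s, kap0; auto_derive; trivial; nra.
  + generalize (kap0_bound t Ht), (dnu_bounds t Ht); intros Hk Hn.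
    assert (Hd2 : 0 <= t ^ 2 / (1 - t ^ 2) <= 2 * t ^ 2).
    { split; [apply Hn|]; apply Rmult_le_reg_r with (1 - t ^ 2); [nra|].
      unfold Rdiv; rewrite Rmult_assoc, Rinv_l by nra; nra. }
    assert (0 <= t ^ 2 <= 1) by nra.
    assert (0 <= t ^ 2 * kap0 t <= t ^ 2) by (split; nra).
    assert (t ^ 4 / (1 - t ^ 2) = t ^ 2 * (t ^ 2 / (1 - t ^ 2))) by (field; nra).
    destruct j as [|[|[|[|j]]]]; try lia; unfold f_s; apply Rabs_le; nra.
Qed.

(** * The change of variable between nu and the density *)

Lemma is_derive_nu r : -1 < r < 1 -> is_derive nu_of_rho r (dnu r).
Proof.
intros Hr.
assert (Hc : forall z, -1 < z < 1 -> continuous dnu z).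
{ intros z Hz; apply differentiable_continuous; unfold dnu; auto_derive; nra. }
apply (is_derive_RInt dnu nu_of_rho 0); auto.
assert (Hd : 0 < Rmin (1 - r) (1 + r)) by (apply Rmin_pos; lra).
exists (mkposreal _ Hd); intros y Hy.
change (Rabs (y - r) < Rmin (1 - r) (1 + r)) in Hy.
assert (H1 := Rlt_le_trans _ _ _ Hy (Rmin_l _ _)).
assert (H2 := Rlt_le_trans _ _ _ Hy (Rmin_r _ _)).
apply Rabs_def2 in H1; apply Rabs_def2 in H2.
apply (RInt_correct dnu), (ex_RInt_continuous (V := R_CompleteNormedModule)).
intros z Hz; apply Hc; revert Hz; unfold Rmin, Rmax; destruct Rle_dec; lra.
Qed.

Lemma nu0 : nu_of_rho 0 = 0.
Proof. exact (RInt_point 0 dnu). Qed.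

Lemma dnu_pos r : 0 < r < 1 -> 0 < dnu r.
Proof. intros Hr; apply Rdiv_lt_0_compat; nra. Qed.

Lemma nu_incr y x : 0 <= y -> y < x -> x < 1 -> nu_of_rho y < nu_of_rho x.
Proof.
intros Hy Hyx Hx.
destruct (MVT_cor2 nu_of_rho dnu y x Hyx) as [c [E Hc]].
- intros c Hc; apply is_derive_Reals, is_derive_nu; lra.
- assert (0 < dnu c) by (apply dnu_pos; lra).
  assert (0 < dnu c * (x - y)) by (apply Rmult_lt_0_compat; lra); lra.
Qed.

Lemma sonic_density : 0 < 1 / sqrt 2 < 1 /\ 2 * (1 / sqrt 2) ^ 2 = 1.
Proof.
assert (Hs : 0 < sqrt 2) by (apply sqrt_lt_R0; lra).
assert (Hs2 : sqrt 2 * sqrt 2 = 2) by (apply sqrt_sqrt; lra).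
assert (E : 2 * (1 / sqrt 2) ^ 2 = 1).
{ replace (2 * (1 / sqrt 2) ^ 2) with (2 * / (sqrt 2 * sqrt 2)) by (field; lra).
  rewrite Hs2; field. }
assert (0 < 1 / sqrt 2) by (apply Rdiv_lt_0_compat; lra).
repeat split; auto; nra.
Qed.

Lemma dom_sonic r : dom r <-> 0 <= r < 1 / sqrt 2.
Proof.
destruct sonic_density as [H1 H2]; set (c := 1 / sqrt 2) in *.
unfold dom; split; intros H; split; try lra; nra.
Qed.

Lemma nu_range r : 0 < r -> dom r -> 0 < nu_of_rho r < nu_cr.
Proof.
intros Hr Hd; apply dom_sonic in Hd; destruct sonic_density as [H1 H2].
split; [rewrite <- nu0|]; apply nu_incr; lra.
Qed.

Lemma nu_cr_pos : 0 < nu_cr.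
Proof.
rewrite <- nu0; destruct sonic_density; apply nu_incr; lra.
Qed.

Lemma nu_surj nu : 0 < nu < nu_cr -> exists r, 0 < r /\ dom r /\ nu_of_rho r = nu.
Proof.
intros Hnu; destruct sonic_density as [H1 H2].
destruct (Ranalysis5.IVT_interv (fun r => nu_of_rho r - nu) 0 (1 / sqrt 2)) as [r [Hr E]].
- intros a Ha; apply continuity_pt_filterlim.
  apply (differentiable_continuous (fun r => nu_of_rho r - nu)).
  exists (dnu a - 0); apply (is_derive_minus nu_of_rho (fun _ => nu)).
  + apply is_derive_nu; lra.
  + apply (is_derive_const (V := R_NormedModule)).
- lra.
- rewrite nu0; lra.
- fold nu_cr; lra.
- assert (E' : nu_of_rho r = nu) by lra.
  exists r; repeat split; auto; try lra.
  + destruct Hr as [[Hr|<-] _]; auto; rewrite nu0 in E'; lra.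
  + apply dom_sonic; split; [lra|]; destruct Hr as [_ [Hr| ->]]; auto.
    fold nu_cr in E'; lra.
Qed.

Section Rho.

Variable rho : R -> R.
Hypothesis Hrho : forall r, 0 <= r < 1 -> rho (nu_of_rho r) = r.

(** Surjectivity of [nu_of_rho] upgrades the left inverse [rho] to a two-sided one on (0, nu_cr). *)
Lemma rho_spec nu : 0 < nu < nu_cr ->
  0 < rho nu /\ dom (rho nu) /\ nu_of_rho (rho nu) = nu.
Proof.
intros Hnu; destruct (nu_surj nu Hnu) as [r [Hr [Hd E]]].
assert (Er : rho nu = r).
{ rewrite <- E; apply Hrho; generalize (dom_lt_1 r Hd); lra. }
rewrite Er; auto.
Qed.

Lemma rho_lt nu r : 0 < nu < nu_cr -> 0 <= r < 1 ->
  nu < nu_of_rho r -> rho nu < r.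
Proof.
intros Hnu Hr H; destruct (rho_spec nu Hnu) as [H1 [H2 H3]].
destruct (Rlt_le_dec (rho nu) r) as [|Hle]; auto.
assert (nu_of_rho r <= nu); [rewrite <- H3|lra].
destruct Hle as [Hlt|E]; [|rewrite E; lra].
apply Rlt_le, nu_incr; [lra | lra | now apply dom_lt_1].
Qed.

Lemma rho_gt nu r : 0 < nu < nu_cr -> 0 <= r < 1 ->
  nu_of_rho r < nu -> r < rho nu.
Proof.
intros Hnu Hr H; destruct (rho_spec nu Hnu) as [H1 [H2 H3]].
destruct (Rlt_le_dec r (rho nu)) as [|Hle]; auto.
assert (nu <= nu_of_rho r); [rewrite <- H3|lra].
destruct Hle as [Hlt|E]; [|rewrite E; lra].
apply Rlt_le, nu_incr; lra.
Qed.

Lemma filterlim_rho : filterlim rho (at_right 0) (at_right 0).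
Proof.
intros P [d Hd].
pose proof (Rmin_l (d / 2) (1 / 2)); pose proof (Rmin_r (d / 2) (1 / 2)).
set (r := Rmin (d / 2) (1 / 2)) in *.
assert (Hr : 0 < r) by (apply Rmin_pos; [generalize (cond_pos d) |]; lra).
assert (Hdr : dom r) by (split; nra).
assert (Hn := nu_range r Hr Hdr).
exists (mkposreal _ (proj1 Hn)); intros y Hy Hy0.
change (Rabs (y - 0) < nu_of_rho r) in Hy.
rewrite Rminus_0_r, Rabs_pos_eq in Hy by lra.
assert (Hlt : rho y < r) by (apply rho_lt; lra).
destruct (rho_spec y) as [H1 _]; [lra|].
apply Hd; auto; change (Rabs (rho y - 0) < d).
rewrite Rminus_0_r, Rabs_pos_eq by lra; generalize (cond_pos d); lra.
Qed.

Lemma is_derive_rho nu : 0 < nu < nu_cr -> is_derive rho nu (/ dnu (rho nu)).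
Proof.
intros Hnu; destruct (rho_spec nu Hnu) as [Hr [Hd E]].
set (r := rho nu) in *; assert (Hr1 := dom_lt_1 r Hd).
set (d := dnu r); assert (Hd0 : 0 < d) by (apply dnu_pos; lra).
apply is_derive_two_point; intros eps Heps.
(* With D the increment of [rho], the first entry yields d D <= 2 (x - y); the second then brings
   the error [eta * D / d] below [eps * (x - y)]. *)
set (eta := Rmin (d / 2) (eps * d ^ 2 / 2)).
assert (Heta : 0 < eta).
{ apply Rmin_pos; [lra|]; assert (0 < eps * d ^ 2); [|lra].
  apply Rmult_lt_0_compat; auto; now apply pow_lt. }
assert (Heta1 : eta <= d / 2) by apply Rmin_l.
assert (Heta2 : eta <= eps * d ^ 2 / 2) by apply Rmin_r.
destruct (two_point_is_derive nu_of_rho r d (is_derive_nu r ltac:(lra)) eta Heta)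
  as [d1 [Hd1 H1]].
destruct (dom_locally r Hr Hd) as [d2 H2].
pose proof (Rmin_l d1 d2); pose proof (Rmin_r d1 d2).
(* The nu-neighbourhood used is the image of (r - m, r + m); monotonicity keeps [rho] inside it, and
   the half makes the increment D smaller than [d1]. *)
set (m := Rmin d1 d2 / 2).
assert (Hm : 0 < Rmin d1 d2) by (apply Rmin_pos; auto; apply cond_pos).
assert (Hmp : 0 < m) by (unfold m; lra).
destruct (H2 (r - m)) as [Hm0 Hm1].
{ change (Rabs (r - m - r) < d2).
  replace (r - m - r) with (- m) by ring; rewrite Rabs_Ropp, Rabs_pos_eq; unfold m; lra. }
destruct (H2 (r + m)) as [_ Hm2].
{ change (Rabs (r + m - r) < d2).
  replace (r + m - r) with m by ring; rewrite Rabs_pos_eq; unfold m; lra. }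
assert (Hm3 := dom_lt_1 _ Hm2).
assert (L1 : nu_of_rho (r - m) < nu) by (rewrite <- E; apply nu_incr; unfold m in *; lra).
assert (L2 : nu < nu_of_rho (r + m)) by (rewrite <- E; apply nu_incr; unfold m in *; lra).
assert (N1 := nu_range (r - m) Hm0 Hm1).
assert (N2 : nu_of_rho (r + m) < nu_cr) by (apply nu_range; auto; unfold m in *; lra).
exists (Rmin (nu - nu_of_rho (r - m)) (nu_of_rho (r + m) - nu)); split;
  [apply Rmin_pos; lra|].
intros y x Hyx Hor Hxy.
assert (X1 := Rlt_le_trans _ _ _ Hxy (Rmin_l _ _)).
assert (X2 := Rlt_le_trans _ _ _ Hxy (Rmin_r _ _)).
assert (Hy : nu_of_rho (r - m) < y) by lra.
assert (Hx : x < nu_of_rho (r + m)) by lra.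
destruct (rho_spec y) as [Ry1 [Ry2 Ry3]]; [lra|].
destruct (rho_spec x) as [Rx1 [Rx2 Rx3]]; [lra|].
assert (Gy : r - m < rho y) by (apply rho_gt; lra).
assert (Gx : rho x < r + m) by (apply rho_lt; lra).
assert (Ryx : rho y <= rho x).
{ destruct (Rle_lt_dec (rho y) (rho x)) as [|Hlt]; auto.
  assert (nu_of_rho (rho x) < nu_of_rho (rho y))
    by (apply nu_incr; auto using dom_lt_1, Rlt_le); lra. }
specialize (H1 (rho y) (rho x) Ryx).
rewrite Ry3, Rx3 in H1.
assert (H3 : Rabs (x - y - d * (rho x - rho y)) <= eta * (rho x - rho y)).
{ apply H1; [destruct Hor as [->| ->]; auto | unfold m in *; lra]. }
clear H1; set (D := rho x - rho y) in *.
assert (HD : 0 <= D) by (unfold D; lra).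
apply Rabs_le_between in H3.
assert (H4 : D * d <= 2 * (x - y)) by nra.
assert (H5 : eta * D * d <= eps * d ^ 2 * (x - y)).
{ apply Rle_trans with (eps * d ^ 2 / 2 * (2 * (x - y))); [|lra].
  rewrite Rmult_assoc; apply Rmult_le_compat; try lra; now apply Rmult_le_pos; lra. }
replace (D - / d * (x - y)) with (- (/ d * (x - y - d * D))) by (field; lra).
rewrite Rabs_Ropp, Rabs_mult, Rabs_pos_eq by (apply Rlt_le, Rinv_0_lt_compat; lra).
apply Rmult_le_reg_l with d; auto.
rewrite <- Rmult_assoc, Rinv_r, Rmult_1_l by lra.
apply Rle_trans with (eta * D); [now apply Rabs_le_between|].
apply Rmult_le_reg_r with d; auto.
replace (d * (eps * (x - y)) * d) with (eps * d ^ 2 * (x - y)) by ring; lra.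
Qed.

Lemma sonic_locally nu : 0 < nu < nu_cr -> locally nu (fun t => 0 < t < nu_cr).
Proof.
intros Hnu; apply filter_and; [apply open_gt | apply open_lt]; lra.
Qed.

Lemma sonic_at_right : at_right 0 (fun t => 0 < t < nu_cr).
Proof.
exists (mkposreal _ nu_cr_pos); intros y Hy Hy0; split; auto.
change (Rabs (y - 0) < nu_cr) in Hy.
rewrite Rminus_0_r, Rabs_pos_eq in Hy; lra.
Qed.

(** Both sides tend to 0 at the vacuum and have the same derivative, because [speed / dnu] is sqrt(1
    - 2 rho^2) / rho^2. *)
Lemma cone_rho k : k 0 = 0 -> filterlim k (at_right 0) (locally 0) ->
  (forall nu, 0 < nu < nu_cr ->
     is_derive k nu (sqrt (1 - 2 * (rho nu) ^ 2) / (rho nu) ^ 2)) ->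
  forall nu, 0 < nu < nu_cr -> k nu = cone (rho nu).
Proof.
intros Hk0 Hkc Hk nu Hnu; apply Rminus_diag_uniq.
apply (constant_zero (fun nu => k nu - cone (rho nu))); [lra| |].
- intros t Ht; assert (Htn : 0 < t < nu_cr) by lra.
  destruct (rho_spec t Htn) as [Hr [Hd _]].
  assert (H := is_derive_minus _ _ _ _ _ (Hk t Htn)
    (is_derive_comp _ _ _ _ _ (is_derive_cone _ Hr Hd) (is_derive_rho t Htn))).
  apply (is_derive_eq _ _ _ _ H).
  unfold minus, plus, opp, scal; simpl; unfold mult; simpl.
  change (rho t * (rho t * 1)) with (rho t ^ 2).
  assert (Hr1 := dom_lt_1 _ Hd).
  unfold speed, dnu; field; split; nra.
- assert (Hc : filterlim (fun nu => cone (rho nu)) (at_right 0) (locally 0)).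
  { apply (filterlim_comp _ _ _ rho cone _ (at_right 0)); [apply filterlim_rho|].
    apply (filterlim_linear_bound _ _ 1); intros r Hr.
    destruct (weight_small r Hr) as [Hd _].
    generalize (cone_incr 0 r dom0 Hd); rewrite cone0; intros Hc.
    apply Rabs_le; lra. }
  apply filterlim_locally; intros eps.
  assert (He : 0 < eps / 2) by (generalize (cond_pos eps); lra).
  generalize (filter_and _ _
    (proj1 (filterlim_locally _ _) Hkc (mkposreal _ He))
    (proj1 (filterlim_locally _ _) Hc (mkposreal _ He))).
  apply filter_imp; intros x [B1 B2].
  change (Rabs (k x - 0) < eps / 2) in B1; change (Rabs (cone (rho x) - 0) < eps / 2) in B2.
  change (Rabs (k x - cone (rho x) - 0) < eps).
  apply Rabs_def2 in B1; apply Rabs_def2 in B2; apply Rabs_def1; lra.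
Qed.

(** * The corrected expansion as a distribution depending on nu *)

Section Solution.

Variables al be f : nat -> R -> R.
Hypothesis HA : ansatz al be f.

Definition solution (nu : R) (phi : R -> R) : R := core al f (rho nu) phi.

Lemma is_derive_solution nu phi : 0 < nu < nu_cr -> is_test_fun phi ->
  is_derive (fun t => solution t phi) nu (core_vel be f (rho nu) phi).
Proof.
intros Hnu Hphi; destruct (rho_spec nu Hnu) as [Hr [Hd _]].
assert (H := is_derive_comp (fun r => core al f r phi) rho nu _ _
  (is_derive_core al be f HA phi _ Hphi Hr Hd) (is_derive_rho nu Hnu)).
apply (is_derive_eq _ _ _ _ H).
assert (0 < dnu (rho nu)) by (apply dnu_pos; split; auto; now apply dom_lt_1).
unfold scal; simpl; unfold mult; simpl; field; lra.
Qed.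

Lemma wave_solution_solution : wave_solution rho solution.
Proof.
intros nu Hnu phi Hphi; split.
- eexists; now apply is_derive_solution.
- apply (is_derive_ext_loc (fun t => core_vel be f (rho t) phi)).
  + generalize (sonic_locally nu Hnu); apply filter_imp; intros t Ht.
    symmetry; apply is_derive_unique; now apply is_derive_solution.
  + destruct (rho_spec nu Hnu) as [Hr [Hd _]].
    assert (H := is_derive_comp (fun r => core_vel be f r phi) rho nu _ _
      (is_derive_core_vel al be f HA phi _ Hphi Hr Hd) (is_derive_rho nu Hnu)).
    apply (is_derive_eq _ _ _ _ H).
    (* The chain rule divides by [dnu]: [kap / dnu] is (1 - 2 r^2) / r^4, which is (M^2 - 1) / r^2
       as M^2 = (1 - r^2) / r^2. *)
    unfold solution; set (c := core _ _ _ _); set (r := rho nu) in *.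
    assert (Hr1 := dom_lt_1 r Hd).
    unfold scal; simpl; unfold mult; simpl; unfold kap, dnu.
    change (r * (r * 1)) with (r ^ 2); change (mach r * (mach r * 1)) with (mach r ^ 2).
    unfold mach; replace ((sqrt (1 - r ^ 2) / r) ^ 2) with (sqrt (1 - r ^ 2) ^ 2 / r ^ 2) by (field; lra).
    replace (sqrt (1 - r ^ 2) ^ 2) with (1 - r ^ 2) by (rewrite pow2_sqrt; nra).
    field; split; nra.
Qed.

Lemma is_distribution_solution nu : 0 < nu < nu_cr -> is_distribution (solution nu).
Proof.
intros Hnu; destruct (rho_spec nu Hnu) as [Hr [Hd _]]; split.
- intros; now apply (core_lin al be f HA).
- intros M; eexists; exists 6%nat; intros phi B Hphi _ HB.
  exact (core_bound al be f HA _ phi B Hd Hphi (fun j x Hj => HB j x Hj)).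
Qed.

Lemma supported_solution nu : 0 < nu < nu_cr ->
  supported_in_interval (solution nu) (cone (rho nu)).
Proof.
intros Hnu phi Hphi [eps [He H]]; destruct (rho_spec nu Hnu) as [Hr [Hd _]].
exact (core_supp al be f HA _ phi eps Hd Hphi He H).
Qed.

Lemma solution_limit phi l K :
  (forall r, 0 < r <= 1 / 2 -> Rabs (core al f r phi - l) <= K * r) ->
  filterlim (fun nu => solution nu phi) (at_right 0) (locally l).
Proof.
intros H; apply (filterlim_comp _ _ _ rho (fun r => core al f r phi) _ (at_right 0)).
- apply filterlim_rho.
- exact (filterlim_linear_bound _ _ K H).
Qed.

(** The factor [m] serves both normalisations of the initial velocity, 1 for [Hr] and the density
    for [Hs]. *)
Lemma solution_deriv_limit phi (m : R -> R) l K : is_test_fun phi ->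
  (forall r, 0 < r <= 1 / 2 -> Rabs (m r * core_vel be f r phi - l) <= K * r) ->
  filterlim (fun nu => m (rho nu) * Derive (fun t => solution t phi) nu)
    (at_right 0) (locally l).
Proof.
intros Hphi H.
apply (filterlim_ext_loc (fun nu => m (rho nu) * core_vel be f (rho nu) phi)).
- generalize sonic_at_right; apply filter_imp; intros t Ht; f_equal.
  symmetry; apply is_derive_unique; now apply is_derive_solution.
- apply (filterlim_comp _ _ _ rho (fun r => m r * core_vel be f r phi) _ (at_right 0)).
  + apply filterlim_rho.
  + exact (filterlim_linear_bound _ _ K H).
Qed.

End Solution.

End Rho.

Lemma small_mult u a r : - r <= u <= r -> Rabs (u * a) <= Rabs a * r.
Proof.
intros H; rewrite Rabs_mult, Rmult_comm.
apply Rmult_le_compat_l; [apply Rabs_pos | now apply Rabs_le].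
Qed.

Theorem theorem2p1 (rho k : R -> R)
  (Hrho : forall r, 0 <= r < 1 -> rho (nu_of_rho r) = r)
  (Hk0 : k 0 = 0)
  (Hkc : filterlim k (at_right 0) (locally 0))
  (Hk' : forall nu, 0 < nu < nu_cr ->
           is_derive k nu (sqrt (1 - 2 * (rho nu) ^ 2) / (rho nu) ^ 2)) :
  exists Hr Hs : R -> (R -> R) -> R,
    (forall nu, 0 < nu < nu_cr ->
       is_distribution (Hr nu) /\ supported_in_interval (Hr nu) (k nu) /\
       is_distribution (Hs nu) /\ supported_in_interval (Hs nu) (k nu)) /\
    wave_solution rho Hr /\ wave_solution rho Hs /\
    (forall phi, is_test_fun phi ->
       filterlim (fun nu => Hr nu phi) (at_right 0) (locally 0) /\
       filterlim (fun nu => Derive (fun t => Hr t phi) nu) (at_right 0)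
         (locally (phi 0))) /\
    (forall phi, is_test_fun phi ->
       filterlim (fun nu => Hs nu phi) (at_right 0) (locally (phi 0)) /\
       filterlim (fun nu => rho nu * Derive (fun t => Hs t phi) nu) (at_right 0)
         (locally (- Derive_n phi 2 0))).
Proof.
exists (solution rho al_r f_r), (solution rho al_s f_s).
assert (Hk := cone_rho rho Hrho k Hk0 Hkc Hk').
split; [|split; [|split; [|split]]].
- intros nu Hnu; rewrite (Hk nu Hnu); repeat split;
  first [ now apply (is_distribution_solution rho Hrho _ _ _ ansatz_r)
        | now apply (is_distribution_solution rho Hrho _ _ _ ansatz_s)
        | now apply (supported_solution rho Hrho _ _ _ ansatz_r)
        | now apply (supported_solution rho Hrho _ _ _ ansatz_s) ].
- exact (wave_solution_solution rho Hrho _ _ _ ansatz_r).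
- exact (wave_solution_solution rho Hrho _ _ _ ansatz_s).
- intros phi Hphi.
  destruct (core_small _ _ _ ansatz_r phi Hphi) as [K [HK Hs]].
  set (a0 := phi 0); set (a1 := Derive_n phi 2 0).
  split.
  + apply (solution_limit rho Hrho _ _ phi 0 (K + Rabs a0 + Rabs a1)); intros r Hr.
    destruct (Hs r Hr) as [H _]; clear Hs.
    cbn [sum_f_R0 al_r Nat.mul Nat.add] in H; change (Derive_n phi 0 0) with a0 in H.
    fold a1 in H.
    assert (P2 : 0 <= r ^ 2 <= 1) by nra.
    assert (P3 : 0 <= r ^ 3 <= r) by (simpl; nra).
    assert (P5 : 0 <= r ^ 5 <= r) by (replace (r ^ 5) with (r ^ 3 * r ^ 2) by ring; nra).
    generalize (small_mult (r ^ 3 / 3 + r ^ 5 / 5) a0 r ltac:(lra)),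
      (small_mult (r ^ 5 / 30) a1 r ltac:(lra)); intros Q0 Q1.
    apply Rabs_le_between in H; apply Rabs_le_between in Q0; apply Rabs_le_between in Q1.
    apply Rabs_le; lra.
  + apply (filterlim_ext
      (fun nu => 1 * Derive (fun t => solution rho al_r f_r t phi) nu));
      [intros; apply Rmult_1_l|].
    apply (solution_deriv_limit rho Hrho _ _ _ ansatz_r phi (fun _ => 1) a0
      (K + Rabs a0 + Rabs a1)); auto; intros r Hr.
    destruct (Hs r Hr) as [_ H]; clear Hs.
    cbn [sum_f_R0 be_r Nat.mul Nat.add] in H; change (Derive_n phi 0 0) with a0 in H.
    fold a1 in H.
    assert (P2 : 0 <= r ^ 2 <= r) by nra.
    assert (P4 : 0 <= r ^ 4 <= r) by (replace (r ^ 4) with (r ^ 2 * r ^ 2) by ring; nra).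
    generalize (small_mult (r ^ 4) a0 r ltac:(lra)),
      (small_mult (r ^ 2 * (1 - r ^ 2) / 6) a1 r ltac:(lra)); intros Q0 Q1.
    apply Rabs_le_between in H; apply Rabs_le_between in Q0; apply Rabs_le_between in Q1.
    apply Rabs_le; lra.
- intros phi Hphi.
  destruct (core_small _ _ _ ansatz_s phi Hphi) as [K [HK Hs]].
  set (a0 := phi 0); set (a1 := Derive_n phi 2 0); set (a2 := Derive_n phi 4 0).
  split.
  + apply (solution_limit rho Hrho _ _ phi a0 (K + Rabs a1 + Rabs a2)); intros r Hr.
    destruct (Hs r Hr) as [H _]; clear Hs.
    cbn [sum_f_R0 al_s Nat.mul Nat.add] in H; change (Derive_n phi 0 0) with a0 in H.
    fold a1 a2 in H.
    assert (P2 : 0 <= r ^ 2 <= r) by nra.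
    assert (P4 : 0 <= r ^ 4 <= r) by (replace (r ^ 4) with (r ^ 2 * r ^ 2) by ring; nra).
    generalize (small_mult (- r ^ 2 / 2 - r ^ 4 / 2) a1 r ltac:(lra)),
      (small_mult (- r ^ 4 / 8) a2 r ltac:(lra)); intros Q1 Q2.
    apply Rabs_le_between in H; apply Rabs_le_between in Q1; apply Rabs_le_between in Q2.
    apply Rabs_le; lra.
  + apply (solution_deriv_limit rho Hrho _ _ _ ansatz_s phi (fun r => r) (- a1)
      (K + Rabs a1 + Rabs a2)); auto; intros r Hr.
    destruct (Hs r Hr) as [_ H]; clear Hs.
    cbn [sum_f_R0 be_s Nat.mul Nat.add] in H; fold a1 a2 in H.
    set (X := core_vel be_s f_s r phi) in *.
    assert (P2 : 0 <= r ^ 2 <= r) by nra.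
    assert (P2' : r ^ 2 <= 1 / 4) by nra.
    assert (P4 : 0 <= r ^ 4 <= r ^ 2 / 4)
      by (replace (r ^ 4) with (r ^ 2 * r ^ 2) by ring; nra).
    (* [r * be_s 1 r] is -1 - r^2 + 2 r^4 and [r * be_s 2 r] is -(r^2 - r^4) / 2; only the -1
       survives in the limit. *)
    generalize (small_mult (- r ^ 2 + 2 * r ^ 4) a1 r ltac:(lra)),
      (small_mult (- (r ^ 2 - r ^ 4) / 2) a2 r ltac:(lra)); intros Q1 Q2.
    (* Multiplying the estimate by [r] clears the pole of [be_s 1] before comparing with the
       limit. *)
    apply Rmult_le_compat_l with (r := r) in H; [|lra].
    rewrite <- (Rabs_pos_eq r) in H at 1 by lra.
    rewrite <- Rabs_mult in H.
    match type of H with Rabs ?e <= _ =>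
      replace e with (r * X + a1 - (- r ^ 2 + 2 * r ^ 4) * a1
        - (- (r ^ 2 - r ^ 4) / 2) * a2) in H by (field; lra) end.
    assert (P : r * (K * r) <= K * r) by nra.
    apply Rabs_le_between in H; apply Rabs_le_between in Q1; apply Rabs_le_between in Q2.
    apply Rabs_le; lra.
Qed.
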